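(* If there exists a polynomial-time bicriteria $(\alpha,\beta)$-approximation algorithm for Budgeted Precedence Constrained Set Cover (BPCSC), then there exists a polynomial-time bicriteria $(\mathcal{O}(\alpha\cdot\beta^3),\,\beta)$-approximation algorithm for Precedence Constrained Min-Sum Set Cover (PCMSSC).
   Context: Universe $\mathcal{U}$ of $n$ items, family $\mathcal{S}$ of $m$ subsets with union $\mathcal{U}$, partial order $\preceq$ on $\mathcal{S}$. A subfamily is precedence-closed if downward closed under $\preceq$; $\mathrm{cov}$ denotes union. BPCSC: given budget $k>0$, find precedence-closed $\mathcal{C}$ with $|\mathcal{C}|\le k$ maximizing $|\mathrm{cov}(\mathcal{C})|$; an $(\alpha,\beta)$-approximation returns a precedence-closed $\mathcal{C}$ with $|\mathrm{cov}(\mathcal{C})|\ge \mathrm{OPT}/\beta$ and $|\mathcal{C}|\le\alpha k$. A precedence-closed sequence $\mathcal{C}=(C_1,\dots,C_l)$ is an ordering of a precedence-closed subfamily with $C_i\preceq C_j\Rightarrow i<j$. The coverage time of $x$ in $\mathcal{C}$ is the least $i$ with $x\in C_i$ if $x\in\mathrm{cov}(\mathcal{C})$, and $|\mathcal{C}|$ otherwise; $\mathrm{CoverTime}(\mathcal{C})$ is the sum of coverage times of elements of $\mathrm{cov}(\mathcal{C})$. PCMSSC: given $0<f\le1$, find a precedence-closed sequence $\mathcal{C}$ with $|\mathrm{cov}(\mathcal{C})|\ge fn$ minimizing $\mathrm{CoverTime}(\mathcal{C})$; an $(\alpha,\beta)$-approximation returns such a sequence with $|\mathrm{cov}(\mathcal{C})|\ge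 fn/\beta$ and $\mathrm{CoverTime}(\mathcal{C})\le\alpha\cdot\mathrm{OPT}$. *)

(* Defs.v *)
From mathcomp Require Export all_boot all_order all_algebra reals.

Set Implicit Arguments.
Unset Strict Implicit.
Unset Printing Implicit Defensive.

(** * Polynomial-time computation

  The machine model is the imperative language WHILE over binary trees
  (N. D. Jones, "Computability and Complexity from a Programming Perspective",
  1997).  Elementary steps are pointer operations on shared trees: no primitive
  copies or compares whole trees, and [If]/[While] only test for [Leaf].
  Counting elementary steps is therefore a reasonable cost measure, polynomially
  equivalent to Turing-machine time.  (Sharing can make a tree exponentially
  larger than the number of steps building it, but not deeper; the answers below
  are lists of bits or of unary numbers, which are read along their spines.) *)

Inductive tree : Type := Leaf | Node of tree & tree.

Fixpoint tree_size (t : tree) : nat :=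
  if t is Node a b then (tree_size a + tree_size b).+1 else 1.

Definition left_tree (t : tree) : tree := if t is Node a _ then a else Leaf.
Definition right_tree (t : tree) : tree := if t is Node _ b then b else Leaf.
Definition is_node (t : tree) : bool := if t is Node _ _ then true else false.

Inductive expr : Type :=
  | Var of nat
  | Nil
  | Cons of expr & expr
  | Hd of expr
  | Tl of expr.

Inductive cmd : Type :=
  | Skip
  | Assign of nat & expr
  | Seq of cmd & cmd
  | If of expr & cmd & cmd
  | While of expr & cmd.

Definition store : Type := nat -> tree.

Definition update (s : store) (v : nat) (t : tree) : store :=
  fun w => if w == v then t else s w.

Fixpoint eval (s : store) (e : expr) : tree :=
  match e with
  | Var v => s v
  | Nil => Leaf
  | Cons e1 e2 => Node (eval s e1) (eval s e2)
  | Hd e1 => left_tree (eval s e1)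
  | Tl e1 => right_tree (eval s e1)
  end.

(* [exec c s t s']: started in [s], [c] halts in [s'] after [t] steps.  An
   expression costs one step: its number of operations is a constant of the
   program. *)
Inductive exec : cmd -> store -> nat -> store -> Prop :=
  | ExecSkip s : exec Skip s 1 s
  | ExecAssign s v e : exec (Assign v e) s 1 (update s v (eval s e))
  | ExecSeq c1 c2 s s1 s2 t1 t2 of exec c1 s t1 s1 & exec c2 s1 t2 s2 :
      exec (Seq c1 c2) s (t1 + t2) s2
  | ExecIfTrue e c1 c2 s s1 t of is_node (eval s e) & exec c1 s t s1 :
      exec (If e c1 c2) s t.+1 s1
  | ExecIfFalse e c1 c2 s s1 t of ~~ is_node (eval s e) & exec c2 s t s1 :
      exec (If e c1 c2) s t.+1 s1
  | ExecWhileFalse e c s of ~~ is_node (eval s e) :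
      exec (While e c) s 1 s
  | ExecWhileTrue e c s s1 s2 t1 t2
      of is_node (eval s e) & exec c s t1 s1 & exec (While e c) s1 t2 s2 :
      exec (While e c) s (t1 + t2).+1 s2.

(* Input and output are both in variable 0; all other variables start at
   [Leaf]. *)
Definition init_store (x : tree) : store := update (fun=> Leaf) 0 x.

Definition computes_in (P : cmd) (x : tree) (t : nat) (y : tree) : Prop :=
  exists2 s : store, exec P (init_store x) t s & s 0 = y.

(* [P] solves the search problem that has instances [x : X] with [valid x],
   written [enc x], and acceptable answers [good x], in polynomial time. *)
Definition polytime_solves (X : Type) (valid : X -> Prop) (enc : X -> tree)
    (good : X -> tree -> Prop) (P : cmd) : Prop :=
  exists a d : nat, forall x : X, valid x ->
    exists t y, [/\ computes_in P (enc x) t y,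
                    t <= a * (tree_size (enc x)) ^ d
                  & good x y].

(** * Encodings *)

Definition enc_bool (b : bool) : tree := if b then Node Leaf Leaf else Leaf.

Definition enc_seq (T : Type) (enc : T -> tree) (s : seq T) : tree :=
  foldr (fun x t => Node (enc x) t) Leaf s.

Fixpoint bits_of_pos (p : BinNums.positive) : seq bool :=
  match p with
  | BinNums.xH => [:: true]
  | BinNums.xO q => false :: bits_of_pos q
  | BinNums.xI q => true :: bits_of_pos q
  end.

(* Binary, least significant bit first, without leading zeros. *)
Definition enc_nat (n : nat) : tree :=
  enc_seq enc_bool
    (if bin_of_nat n is BinNums.Npos p then bits_of_pos p else [::]).

(* Unary; used only for indices of sets, which are bounded by the instance
   size. *)
Definition enc_index (m : nat) (i : 'I_m) : tree :=
  enc_seq enc_bool (nseq i false).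

Definition enc_bitvec (m : nat) (p : pred 'I_m) : tree :=
  enc_seq (fun i => enc_bool (p i)) (enum 'I_m).

(** * Precedence-constrained set systems *)

(* The universe is ['I_items] and the family is indexed by ['I_sets]; the
   partial order is on the members of the family, i.e. on indices. *)
Record instance : Type := Instance {
  items : nat;
  sets : nat;
  member : 'I_sets -> {set 'I_items};
  prec : rel 'I_sets;
  member_cover : \bigcup_(i : 'I_sets) member i = [set: 'I_items];
  prec_refl : reflexive prec;
  prec_anti : antisymmetric prec;
  prec_trans : transitive prec }.

(* Incidence matrix (one row per set) and matrix of the order. *)
Definition enc_instance (I : instance) : tree :=
  Node (enc_seq (fun i => enc_bitvec (fun x => x \in member i)) (enum 'I_(sets I)))
       (enc_seq (fun i => enc_bitvec (fun j => prec i j)) (enum 'I_(sets I))).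

Definition prec_closed (I : instance) (C : {set 'I_(sets I)}) : bool :=
  [forall i in C, forall j, prec j i ==> (j \in C)].

Definition cov (I : instance) (C : {set 'I_(sets I)}) : {set 'I_(items I)} :=
  \bigcup_(i in C) member i.

(** * Budgeted Precedence Constrained Set Cover *)

Definition bpcsc_opt (I : instance) (k : nat) : nat :=
  \max_(C : {set 'I_(sets I)} | prec_closed C && (#|C| <= k)) #|cov C|.

Definition bpcsc_valid (x : instance * nat) : Prop := 0 < x.2.

Definition enc_bpcsc (x : instance * nat) : tree :=
  Node (enc_instance x.1) (enc_nat x.2).

Definition bpcsc_good (R : realType) (alpha beta : R)
    (x : instance * nat) (y : tree) : Prop :=
  exists C : {set 'I_(sets x.1)},
    [/\ y = enc_bitvec (fun i => i \in C),
        prec_closed C,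
        ((bpcsc_opt x.1 x.2)%:R / beta <= #|cov C|%:R)%R
      & (#|C|%:R <= alpha * x.2%:R)%R].

Definition bpcsc_approx_algorithm (R : realType) (alpha beta : R) (P : cmd) : Prop :=
  polytime_solves bpcsc_valid enc_bpcsc (bpcsc_good alpha beta) P.

(** * Precedence Constrained Min-Sum Set Cover *)

Definition prec_closed_seq (I : instance) (s : seq 'I_(sets I)) : bool :=
  [&& uniq s,
      prec_closed [set i in s]
    & [forall i in s, forall j in s,
         (i != j) && prec i j ==> (index i s < index j s)]].

Definition seq_cov (I : instance) (s : seq 'I_(sets I)) : {set 'I_(items I)} :=
  cov [set i in s].

(* Positions are counted from 1. *)
Definition coverage_time (I : instance) (s : seq 'I_(sets I)) (x : 'I_(items I)) : nat :=
  if x \in seq_cov s then (find (fun i => x \in member i) s).+1 else size s.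

Definition cover_time (I : instance) (s : seq 'I_(sets I)) : nat :=
  \sum_(x in seq_cov s) coverage_time s x.

Definition pcmssc_feasible (I : instance) (f : rat) (s : seq 'I_(sets I)) : bool :=
  prec_closed_seq s && (f * (items I)%:R <= #|seq_cov s|%:R :> rat)%R.

(* A precedence-closed sequence is duplicate-free, hence has length at most
   [sets I], so the bounded sequences exhaust the candidates; and every cover
   time is at most [items I * sets I], so this default value does not affect
   the minimum. *)
Definition pcmssc_opt (I : instance) (f : rat) : nat :=
  \big[minn/items I * sets I]_(s : (sets I).-bseq 'I_(sets I)
                               | pcmssc_feasible f s) cover_time s.

Definition pcmssc_valid (x : instance * rat) : Prop := (0 < x.2 <= 1)%R.

(* The rational [f] is given by its reduced numerator and denominator. *)
Definition enc_pcmssc (x : instance * rat) : tree :=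
  Node (enc_instance x.1)
       (Node (enc_nat `|numq x.2|%N) (enc_nat `|denq x.2|%N)).

Definition pcmssc_good (R : realType) (gamma beta : R)
    (x : instance * rat) (y : tree) : Prop :=
  exists s : seq 'I_(sets x.1),
    [/\ y = enc_seq (@enc_index _) s,
        prec_closed_seq s,
        (ratr x.2 * (items x.1)%:R / beta <= #|seq_cov s|%:R)%R
      & ((cover_time s)%:R <= gamma * (pcmssc_opt x.1 x.2)%:R)%R].

Definition pcmssc_approx_algorithm (R : realType) (gamma beta : R) (P : cmd) : Prop :=
  polytime_solves pcmssc_valid enc_pcmssc (pcmssc_good gamma beta) P.

(* Main.v *)
Require Import Defs.
From mathcomp Require Import zify lra.
From mathcomp.classical Require Import boolp.

(* The algorithm runs in levels j = 0, 1, 2, ...; level j consists of t = O(beta)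
   rounds, each of which asks the BPCSC algorithm for a cheap cover of the items not yet
   covered with budget 2^j.  These rounds cover the full target N = ceil(f n) (no loss in
   coverage), because one level reduces by a factor 4 the number of items that
   an optimal sequence covers by time 2^j and the algorithm does not, while time only
   doubles.

   As all covered items count, the danger is to overshoot the target at a late time.  A
   set is a finisher if adding it to the current state reaches the target.  Finishers and
   their successors are hidden from the BPCSC algorithm, so that no round overshoots by
   more than the number of missing items.  For every state and every set i, the state
   extended by the predecessors of i is a further candidate, and the cheapest
   candidate is returned.  If the first 2^j sets of an optimal sequence contain a finisher
   for the first time at level j >= 1, then its new items are few: those that the optimum
   covers by time 2^(j-1) were mostly collected during level j - 1, and the
   others cost the optimum 2^(j-1) each.

   Polynomial running time is obtained by closure properties of the functions
   computed by WHILE programs in polynomial time. *)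

Set Implicit Arguments.
Unset Strict Implicit.
Unset Printing Implicit Defensive.

(** * Calling programs as subroutines *)

(** Cover time is the sum, over all steps, of the number of items of the final cover still missing.
    A sequence that stops at level J with v items beyond the target therefore pays two amounts: the
    deficits accumulated level by level, and v times its length, which is O(A t 2^J). The second
    amount dictates the design: an overshoot v is affordable if 2^J v is O(OPT). A nonfinisher meets
    this, as it brings fewer items than are missing. An arbitrary finisher need not, so the analysis
    relies on one only when the optimum itself has used it by time 2^J; as that set is unknown, all
    sets are tried. Successors are hidden along with finishers so that the hidden sets form an
    upward closed family: discarding them from a closed answer of the oracle leaves a closed family.
    Three items gained for each one left over are what contracts the deficit fast enough against the
    doubling of time. Hence t is about 3 beta, and the factor obtained is O(alpha beta), within
    O(alpha beta^3). *)

Fixpoint expr_below (w : nat) (e : expr) : bool :=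
  match e with
  | Var v => v < w
  | Nil => true
  | Cons e1 e2 => expr_below w e1 && expr_below w e2
  | Hd e1 | Tl e1 => expr_below w e1
  end.

Fixpoint cmd_below (w : nat) (c : cmd) : bool :=
  match c with
  | Skip => true
  | Assign v e => (v < w) && expr_below w e
  | Seq c1 c2 => cmd_below w c1 && cmd_below w c2
  | If e c1 c2 => [&& expr_below w e, cmd_below w c1 & cmd_below w c2]
  | While e c1 => expr_below w e && cmd_below w c1
  end.

Lemma expr_below_leq w w' e : w <= w' -> expr_below w e -> expr_below w' e.
Proof.
move=> le_w; elim: e => //= [v|e1 IH1 e2 IH2]; first by move=> /leq_trans; apply.
by case/andP=> /IH1 -> /IH2 ->.
Qed.

Lemma cmd_below_leq w w' c : w <= w' -> cmd_below w c -> cmd_below w' c.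
Proof.
move=> le_w; elim: c => //= [v e|c1 IH1 c2 IH2|e c1 IH1 c2 IH2|e c IH].
- by case/andP=> /leq_trans-> // /(expr_below_leq le_w).
- by case/andP=> /IH1 -> /IH2 ->.
- by case/and3P=> /(expr_below_leq le_w) -> /IH1 -> /IH2 ->.
- by case/andP=> /(expr_below_leq le_w) -> /IH ->.
Qed.

Lemma expr_below_exists e : exists w, expr_below w e.
Proof.
elim: e => [v||e1 [w1 h1] e2 [w2 h2]|//|//]; first by exists v.+1 => /=.
  by exists 0.
exists (maxn w1 w2) => /=.
by rewrite (expr_below_leq (leq_maxl _ _) h1) (expr_below_leq (leq_maxr _ _) h2).
Qed.

Lemma cmd_below_exists c : exists w, cmd_below w c.
Proof.
elim: c => [|v e|c1 [w1 h1] c2 [w2 h2]|e c1 [w1 h1] c2 [w2 h2]|e c [w1 h1]].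
- by exists 0.
- have [w he] := expr_below_exists e; exists (maxn v.+1 w) => /=.
  by rewrite leq_maxl (expr_below_leq (leq_maxr _ _) he).
- exists (maxn w1 w2) => /=.
  by rewrite (cmd_below_leq (leq_maxl _ _) h1) (cmd_below_leq (leq_maxr _ _) h2).
- have [w he] := expr_below_exists e; exists (maxn w (maxn w1 w2)) => /=.
  rewrite (expr_below_leq (leq_maxl _ _) he) /=.
  rewrite (cmd_below_leq _ h1) ?(cmd_below_leq _ h2) //; lia.
- have [w he] := expr_below_exists e; exists (maxn w w1) => /=.
  by rewrite (expr_below_leq (leq_maxl _ _) he) (cmd_below_leq (leq_maxr _ _) h1).
Qed.

Lemma eval_below w e s r :
  expr_below w e -> (forall v, v < w -> s v = r v) -> eval s e = eval r e.
Proof.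
move=> + eq_sr; elim: e => //= [e1 IH1 e2 IH2|e IH|e IH].
- by case/andP=> /IH1 -> /IH2 ->.
- by move=> /IH ->.
- by move=> /IH ->.
Qed.

(** A run depends only on the variables the program mentions, so it can be replayed in any store
    that agrees with the original one below [w]. Variables from [w] on survive and can serve the
    caller. *)
Lemma exec_frame w c s t s' :
    exec c s t s' -> cmd_below w c ->
    forall r, (forall v, v < w -> s v = r v) ->
  exists r', [/\ exec c r t r', forall v, v < w -> s' v = r' v
               & forall v, w <= v -> r' v = r v].
Proof.
elim=> {c s t s'} /=.
- by move=> s _ r eq_sr; exists r; split=> //; apply: ExecSkip.
- move=> s v e /andP[lt_vw be] r eq_sr; exists (update r v (eval r e)); split.
  + exact: ExecAssign.
  + move=> u lt_uw; rewrite /update; case: eqP => // _; last exact: eq_sr.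
    exact: eval_below be eq_sr.
  + by move=> u le_wu; rewrite /update; case: eqP => // eu; lia.
- move=> c1 c2 s s1 s2 t1 t2 _ IH1 _ IH2 /andP[b1 b2] r eq_sr.
  have [r1 [ex1 eq1 fr1]] := IH1 b1 r eq_sr.
  have [r2 [ex2 eq2 fr2]] := IH2 b2 r1 eq1.
  exists r2; split=> //; first exact: ExecSeq ex1 ex2.
  by move=> v le_wv; rewrite fr2 // fr1.
- move=> e c1 c2 s s1 t te _ IH /and3P[be b1 b2] r eq_sr.
  have [r1 [ex1 eq1 fr1]] := IH b1 r eq_sr.
  by exists r1; split=> //; apply: ExecIfTrue ex1; rewrite -(eval_below be eq_sr).
- move=> e c1 c2 s s1 t te _ IH /and3P[be b1 b2] r eq_sr.
  have [r1 [ex1 eq1 fr1]] := IH b2 r eq_sr.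
  by exists r1; split=> //; apply: ExecIfFalse ex1; rewrite -(eval_below be eq_sr).
- move=> e c s te /andP[be _] r eq_sr; exists r; split=> //.
  by apply: ExecWhileFalse; rewrite -(eval_below be eq_sr).
- move=> e c s s1 s2 t1 t2 te _ IH1 _ IH2 /andP[be b1] r eq_sr.
  have [r1 [ex1 eq1 fr1]] := IH1 b1 r eq_sr.
  have [|r2 [ex2 eq2 fr2]] := IH2 _ r1 eq1; first by rewrite be.
  exists r2; split=> //; last by move=> v le_wv; rewrite fr2 // fr1.
  by apply: ExecWhileTrue ex1 ex2; rewrite -(eval_below be eq_sr).
Qed.

(** A total-correctness triple with a time bound; programs are verified by chaining
    postconditions. *)
Definition terminates (c : cmd) (s : store) (T : nat) (Q : store -> Prop) : Prop :=
  exists t s', [/\ exec c s t s', t <= T & Q s'].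

Lemma terminates_assign v e s (Q : store -> Prop) :
  Q (update s v (eval s e)) -> terminates (Assign v e) s 1 Q.
Proof. by move=> q; exists 1, (update s v (eval s e)); split=> //; apply: ExecAssign. Qed.

Lemma terminates_seq c1 c2 s T1 T2 (Q1 Q2 : store -> Prop) :
    terminates c1 s T1 Q1 -> (forall s1, Q1 s1 -> terminates c2 s1 T2 Q2) ->
  terminates (Seq c1 c2) s (T1 + T2) Q2.
Proof.
move=> [t1 [s1 [ex1 le1 /[swap]/[apply]]]] [t2 [s2 [ex2 le2 q2]]].
exists (t1 + t2), s2; split=> //; first exact: ExecSeq ex1 ex2.
exact: leq_add.
Qed.

Fixpoint clear (w : nat) : cmd :=
  if w is w'.+1 then Seq (Assign w' Nil) (clear w') else Skip.

Lemma terminates_clear w s :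
  terminates (clear w) s w.+1 (fun s' => forall v, s' v = if v < w then Leaf else s v).
Proof.
elim: w s => [|w IH] s /=.
  by exists 1, s; split=> //; apply: ExecSkip.
rewrite -[w.+2]add1n.
apply: (terminates_seq (Q1 := fun s1 => s1 = update s w Leaf)).
  exact: terminates_assign.
move=> s1 ->; have [t [s' [ex le q]]] := IH (update s w Leaf).
exists t, s'; split=> // v; rewrite q /update ltnS.
by case: ltngtP.
Qed.

(* Variables below [w] are scratch space for [P]; the registers of the caller are
   the variables from [w] on. *)
Definition call (P : cmd) (w src dst : nat) : cmd :=
  Seq (clear w) (Seq (Assign 0 (Var src)) (Seq P (Assign dst (Var 0)))).

Lemma terminates_call P w s x t y src dst (Q : store -> Prop) :
    cmd_below w P -> 0 < w -> w <= src -> w <= dst ->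
    s src = x -> computes_in P x t y ->
    (forall s', s' dst = y -> (forall v, w <= v -> v != dst -> s' v = s v) -> Q s') ->
  terminates (call P w src dst) s (t + w + 3) Q.
Proof.
move=> bP w_gt0 le_src le_dst <- [sP exP yE] postQ.
have -> : t + w + 3 = w.+1 + (1 + (t + 1)) by lia.
apply: terminates_seq (terminates_clear w s) _ => s1 q1.
apply: (terminates_seq (Q1 := fun s2 => s2 = update s1 0 (s1 src))).
  exact: terminates_assign.
move=> s2 ->.
have eq_init v : v < w -> init_store (s src) v = update s1 0 (s1 src) v.
  by move=> lt_vw; rewrite /init_store /update !q1 lt_vw ltnNge le_src.
have [s3 [ex3 eq3 fr3]] := exec_frame exP bP eq_init.
apply: (terminates_seq (Q1 := fun s' => s' = s3)); first by exists t, s3.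
move=> _ ->; apply: terminates_assign; apply: postQ; rewrite /update ?eqxx /= -?eq3 //.
move=> v le_wv /negPf ->; rewrite fr3 // /update; case: eqP => [v0|_]; first lia.
by rewrite q1 ltnNge le_wv.
Qed.

(** * Polynomial-time functions *)

Class encodable (T : Type) := encode : T -> tree.

#[export] Instance encodable_bool : encodable bool := enc_bool.
#[export] Instance encodable_seq T {e : encodable T} : encodable (seq T) := enc_seq e.
#[export] Instance encodable_prod S T {eS : encodable S} {eT : encodable T} :
  encodable (S * T) := fun z => Node (encode z.1) (encode z.2).
(* Unary. *)
#[export] Instance encodable_nat : encodable nat := fun n => enc_seq enc_bool (nseq n false).

Definition esize T {e : encodable T} (x : T) : nat := tree_size (encode x).

Lemma tree_size_gt0 x : 0 < tree_size x.
Proof. by case: x. Qed.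

Lemma esize_gt0 T {e : encodable T} (x : T) : 0 < esize x.
Proof. exact: tree_size_gt0. Qed.

Definition pbound X {e : encodable X} (F : X -> nat) : Prop :=
  exists a d, forall x, F x <= a * esize x ^ d.

Section Pbound.
Context X {e : encodable X}.
Implicit Types F G : X -> nat.

Lemma pbound_le F G : (forall x, F x <= G x) -> pbound G -> pbound F.
Proof. by move=> le_FG [a [d leG]]; exists a, d => x; apply: leq_trans (leG x). Qed.

Lemma pbound_const k : pbound (fun _ : X => k).
Proof. by exists k, 0 => x; rewrite muln1. Qed.

Lemma pbound_esize : pbound (fun x => esize x).
Proof. by exists 1, 1 => x; rewrite mul1n. Qed.

Lemma pbound_add F G : pbound F -> pbound G -> pbound (fun x => F x + G x).
Proof.
move=> [a1 [d1 le1]] [a2 [d2 le2]]; exists (a1 + a2), (maxn d1 d2) => x.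
rewrite mulnDl leq_add // (leq_trans (le1 x), leq_trans (le2 x)) //.
- by rewrite leq_mul // leq_pexp2l ?esize_gt0 ?leq_maxl.
- by rewrite leq_mul // leq_pexp2l ?esize_gt0 ?leq_maxr.
Qed.

Lemma pbound_mul F G : pbound F -> pbound G -> pbound (fun x => F x * G x).
Proof.
move=> [a1 [d1 le1]] [a2 [d2 le2]]; exists (a1 * a2), (d1 + d2) => x.
by rewrite expnD mulnACA leq_mul.
Qed.

Lemma pbound_exp F d : pbound F -> pbound (fun x => F x ^ d).
Proof.
move=> bF; elim: d => [|d IH]; first exact: pbound_le (pbound_const 1).
by apply: pbound_le (pbound_mul bF IH) => x; rewrite expnS.
Qed.

Lemma pbound_comp Y {eY : encodable Y} (f : X -> Y) (G : Y -> nat) :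
  pbound G -> pbound (fun x => esize (f x)) -> pbound (fun x => G (f x)).
Proof.
move=> [a [d leG]] bf.
exact: pbound_le (fun x => leG (f x)) (pbound_mul (pbound_const a) (pbound_exp d bf)).
Qed.

End Pbound.

(** The output size is bounded besides the time because sharing lets few steps build a huge tree,
    and in a composition the size of the intermediate value governs the time of the second
    program. *)
Definition polytime X {e : encodable X} (g : X -> tree) : Prop :=
  exists P (T : X -> nat), pbound T /\ forall x, exists t,
    [/\ computes_in P (encode x) t (g x), t <= T x & tree_size (g x) <= T x].

Definition polyfun X Y {eX : encodable X} {eY : encodable Y} (f : X -> Y) : Prop :=
  polytime (fun x => encode (f x)).

Lemma computes_intro P x y T N :
    terminates P (init_store x) T (fun s => s 0 = y) -> T <= N -> tree_size y <= N ->
  exists t, [/\ computes_in P x t y, t <= N & tree_size y <= N].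
Proof.
move=> [t [s [ex le_t s0]]] le_T le_y; exists t; split=> //; first by exists s.
exact: leq_trans le_T.
Qed.

Lemma polytime_ext X {e : encodable X} (g g' : X -> tree) :
  g =1 g' -> polytime g -> polytime g'.
Proof. by move=> /funext ->. Qed.

Lemma pbound_polyfun X Y {eX : encodable X} {eY : encodable Y} (f : X -> Y) :
  polyfun f -> pbound (fun x => esize (f x)).
Proof.
by move=> [P [T [bT fT]]]; apply: pbound_le bT => x; have [t []] := fT x.
Qed.

(** * Closure under composition, pairing and branching *)

Section Combinators.
Context X {eX : encodable X}.

Lemma polytime_comp Y {eY : encodable Y} (f : X -> Y) (g : Y -> tree) :
  polyfun f -> polytime g -> polytime (fun x => g (f x)).
Proof.
move=> pf [Pg [Tg [bTg hg]]]; have bf := pbound_polyfun pf.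
have [Pf [Tf [bTf hf]]] := pf.
have [w1 bel1] := cmd_below_exists Pf; have [w2 bel2] := cmd_below_exists Pg.
pose w := (maxn w1 w2).+1.
have {}bel1 : cmd_below w Pf by apply: cmd_below_leq bel1; rewrite /w; lia.
have {}bel2 : cmd_below w Pg by apply: cmd_below_leq bel2; rewrite /w; lia.
exists (Seq (Assign w (Var 0)) (Seq (call Pf w w w) (Seq (call Pg w w w) (Assign 0 (Var w))))).
exists (fun x => Tf x + Tg (f x) + (2 * w + 8)); split.
  apply: pbound_add (pbound_const _); apply: pbound_add bTf _.
  exact: pbound_comp bTg bf.
move=> x; have [t1 [c1 le1 _]] := hf x; have [t2 [c2 le2 sz2]] := hg (f x).
apply: (computes_intro (T := 1 + ((t1 + w + 3) + ((t2 + w + 3) + 1)))); [|lia|lia].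
apply: (terminates_seq (Q1 := fun s => s w = encode x)).
  by apply: terminates_assign; rewrite /update eqxx.
move=> s1 q1; apply: (terminates_seq (Q1 := fun s => s w = encode (f x))).
  exact: terminates_call q1 c1 _.
move=> s2 q2; apply: (terminates_seq (Q1 := fun s => s w = g (f x))).
  exact: terminates_call q2 c2 _.
by move=> s3 q3; apply: terminates_assign; rewrite /update eqxx.
Qed.

Lemma polytime_id : polytime (fun x => encode x).
Proof.
exists Skip, (fun x => esize x); split; first exact: pbound_esize.
move=> x; exists 1; rewrite esize_gt0; split=> //.
by exists (init_store (encode x)); [apply: ExecSkip|].
Qed.

Lemma polytime_expr (g : X -> tree) (h : tree -> tree) (e : expr) :
    (forall s, eval s e = h (s 0)) -> (forall y, tree_size (h y) <= tree_size y) ->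
  polytime g -> polytime (fun x => h (g x)).
Proof.
move=> eE le_h [P [T [bT hg]]]; exists (Seq P (Assign 0 e)), (fun x => T x + 1).
split; first exact: pbound_add bT (pbound_const 1).
move=> x; have [t [[s ex s0] le_t le_s]] := hg x.
apply: (computes_intro (T := t + 1)); last 2 first.
- lia.
- by apply: leq_trans (leq_trans (le_h _) le_s) _; rewrite leq_addr.
apply: (terminates_seq (Q1 := fun s => s 0 = g x)); first by exists t, s.
by move=> s1 q1; apply: terminates_assign; rewrite /update eqxx eE q1.
Qed.

Lemma polytime_left (g : X -> tree) : polytime g -> polytime (fun x => left_tree (g x)).
Proof. by apply: (polytime_expr (e := Hd (Var 0))) => // -[] //= a b; lia. Qed.

Lemma polytime_right (g : X -> tree) : polytime g -> polytime (fun x => right_tree (g x)).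
Proof. by apply: (polytime_expr (e := Tl (Var 0))) => // -[] //= a b; lia. Qed.

Lemma polytime_const (u : tree) : polytime (fun _ : X => u).
Proof.
pose fix ex v := if v is Node a b then Cons (ex a) (ex b) else Nil.
have exE s v : eval s (ex v) = v by elim: v => //= a -> b ->.
exists (Assign 0 (ex u)), (fun=> 1 + tree_size u); split; first exact: pbound_const.
move=> x; apply: (computes_intro (T := 1)); try lia.
by apply: terminates_assign; rewrite /update eqxx exE.
Qed.

Lemma polytime_node (g h : X -> tree) :
  polytime g -> polytime h -> polytime (fun x => Node (g x) (h x)).
Proof.
move=> [Pg [Tg [bTg hg]]] [Ph [Th [bTh hh]]].
have [w1 bel1] := cmd_below_exists Pg; have [w2 bel2] := cmd_below_exists Ph.
pose w := (maxn w1 w2).+1.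
have {}bel1 : cmd_below w Pg by apply: cmd_below_leq bel1; rewrite /w; lia.
have {}bel2 : cmd_below w Ph by apply: cmd_below_leq bel2; rewrite /w; lia.
exists (Seq (Assign w (Var 0)) (Seq (call Pg w w w.+1) (Seq (call Ph w w w)
  (Assign 0 (Cons (Var w.+1) (Var w)))))).
exists (fun x => Tg x + Th x + (2 * w + 8)); split.
  by apply: pbound_add (pbound_const _); apply: pbound_add bTg _.
move=> x; have [t1 [c1 le1 sz1]] := hg x; have [t2 [c2 le2 sz2]] := hh x.
apply: (computes_intro (T := 1 + ((t1 + w + 3) + ((t2 + w + 3) + 1)))); last 2 first.
- lia.
- by rewrite /=; lia.
apply: (terminates_seq (Q1 := fun s => s w = encode x)).
  by apply: terminates_assign; rewrite /update eqxx.
move=> s1 q1; apply: (terminates_seq (Q1 := fun s => s w = encode x /\ s w.+1 = g x)).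
  apply: terminates_call (q1) c1 _ => // s -> fr; rewrite fr //; lia.
move=> s2 [q2 q2']; apply: (terminates_seq (Q1 := fun s => s w = h x /\ s w.+1 = g x)).
  apply: terminates_call (q2) c2 _ => // s -> fr; rewrite fr //; lia.
by move=> s3 [q3 q3']; apply: terminates_assign; rewrite /update eqxx /= q3 q3'.
Qed.

Lemma polytime_if (c g h : X -> tree) :
    polytime c -> polytime g -> polytime h ->
  polytime (fun x => if is_node (c x) then g x else h x).
Proof.
move=> [Pc [Tc [bTc hc]]] [Pg [Tg [bTg hg]]] [Ph [Th [bTh hh]]].
have [w0 bel0] := cmd_below_exists Pc.
have [w1 bel1] := cmd_below_exists Pg; have [w2 bel2] := cmd_below_exists Ph.
pose w := (maxn w0 (maxn w1 w2)).+1.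
have {}bel0 : cmd_below w Pc by apply: cmd_below_leq bel0; rewrite /w; lia.
have {}bel1 : cmd_below w Pg by apply: cmd_below_leq bel1; rewrite /w; lia.
have {}bel2 : cmd_below w Ph by apply: cmd_below_leq bel2; rewrite /w; lia.
exists (Seq (Assign w (Var 0)) (Seq (call Pc w w w.+1)
  (Seq (If (Var w.+1) (call Pg w w w) (call Ph w w w)) (Assign 0 (Var w))))).
exists (fun x => Tc x + (Tg x + Th x) + (2 * w + 9)); split.
  apply: pbound_add (pbound_const _); apply: pbound_add bTc _.
  exact: pbound_add bTg bTh.
move=> x; have [t0 [c0 le0 sz0]] := hc x.
have [t1 [c1 le1 sz1]] := hg x; have [t2 [c2 le2 sz2]] := hh x.
apply: (computes_intro
  (T := 1 + ((t0 + w + 3) + ((t1 + t2 + w + 3).+1 + 1)))); last 2 first.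
- lia.
- by case: ifP => _; lia.
apply: (terminates_seq (Q1 := fun s => s w = encode x)).
  by apply: terminates_assign; rewrite /update eqxx.
move=> s1 q1; apply: (terminates_seq (Q1 := fun s => s w = encode x /\ s w.+1 = c x)).
  apply: terminates_call (q1) c0 _ => // s -> fr; rewrite fr //; lia.
move=> s2 [q2 q2'].
apply: (terminates_seq (Q1 := fun s => s w = if is_node (c x) then g x else h x)).
  case nc : (is_node (c x)).
    have [|t [s [ex le_t q]]] := @terminates_call Pg w s2 (encode x) t1 (g x) w w
      (fun s => s w = g x) bel1 isT (leqnn _) (leqnn _) q2 c1; first by [].
    exists t.+1, s; split=> //; last lia.
    by apply: ExecIfTrue ex; rewrite /= q2' nc.
  have [|t [s [ex le_t q]]] := @terminates_call Ph w s2 (encode x) t2 (h x) w w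
    (fun s => s w = h x) bel2 isT (leqnn _) (leqnn _) q2 c2; first by [].
  exists t.+1, s; split=> //; last lia.
  by apply: ExecIfFalse ex; rewrite /= q2' nc.
by move=> s3 q3; apply: terminates_assign; rewrite /update eqxx.
Qed.

End Combinators.

Lemma esize_cons T {e : encodable T} (x : T) s : esize (x :: s) = (esize x + esize s).+1.
Proof. by []. Qed.

Lemma esize_pair S T {eS : encodable S} {eT : encodable T} (z : S * T) :
  esize z = (esize z.1 + esize z.2).+1.
Proof. by []. Qed.

Lemma esize_size T {e : encodable T} (s : seq T) : size s < esize s.
Proof. by elim: s => //= x s IH; rewrite esize_cons; have := esize_gt0 x; lia. Qed.

(* Trees can grow exponentially in the number of steps, so the encodings of the
   intermediate values have to be bounded explicitly. *)
Lemma polyfun_foldl X A B {eX : encodable X} {eA : encodable A} {eB : encodable B}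
    (M : X -> nat) (L : X -> seq B) (a0 : X -> A) (step : X -> A -> B -> A) :
    polyfun L -> polyfun a0 -> polyfun (fun z : X * A * B => step z.1.1 z.1.2 z.2) ->
    pbound M ->
    (forall x s1 s2, L x = s1 ++ s2 -> esize (foldl (step x) (a0 x) s1) <= M x) ->
  polyfun (fun x => foldl (step x) (a0 x) (L x)).
Proof.
move=> pL [Pa [Ta [bTa ha]]] [Ps [Ts [[a [d leTs]] hs]]] bM leM.
have bL := pbound_polyfun pL; have [Pl [TL [bTL hl]]] := pL.
have [w0 bel0] := cmd_below_exists Pa.
have [w1 bel1] := cmd_below_exists Ps; have [w2 bel2] := cmd_below_exists Pl.
pose w := (maxn w0 (maxn w1 w2)).+1.
have {}bel0 : cmd_below w Pa by apply: cmd_below_leq bel0; rewrite /w; lia.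
have {}bel1 : cmd_below w Ps by apply: cmd_below_leq bel1; rewrite /w; lia.
have {}bel2 : cmd_below w Pl by apply: cmd_below_leq bel2; rewrite /w; lia.
(* Register [w] holds the input, [w.+1] the accumulator, [w.+2] the unread part of the list and
   [w.+3] the argument of the step program. *)
pose body := Seq (Assign w.+3 (Cons (Cons (Var w) (Var w.+1)) (Hd (Var w.+2))))
  (Seq (call Ps w w.+3 w.+1) (Assign w.+2 (Tl (Var w.+2)))).
(* Bounds one turn of the loop. The argument triple has size controlled by [M x] and [esize (L x)];
   [w + 6] pays for the call, two assignments and the loop test. *)
pose (K := fun x => a * (esize x + M x + esize (L x) + 2) ^ d + (w + 6)).
exists (Seq (Assign w (Var 0)) (Seq (call Pl w w w.+2) (Seq (call Pa w w w.+1)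
  (Seq (While (Var w.+2) body) (Assign 0 (Var w.+1)))))).
exists (fun x => TL x + Ta x + (esize (L x) * K x + M x) + (2 * w + 9)); split.
  apply: pbound_add (pbound_const _); apply: pbound_add.
    exact: pbound_add.
  apply: pbound_add (bM); apply: pbound_mul => //.
  apply: pbound_add (pbound_const _); apply: pbound_mul (pbound_const _) _.
  apply: pbound_exp; apply: pbound_add (pbound_const _).
  by apply: pbound_add bL; apply: pbound_add bM; apply: pbound_esize.
have loop x s2 : forall s1 s, L x = s1 ++ s2 -> s w = encode x ->
    s w.+1 = encode (foldl (step x) (a0 x) s1) -> s w.+2 = encode s2 ->
    terminates (While (Var w.+2) body) s (size s2 * K x + 1)
      (fun s' => s' w.+1 = encode (foldl (step x) (a0 x) (L x))).
  elim: s2 => [|b s2 IH] s1 s LE qx qa ql.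
    exists 1, s; split=> //; first by apply: ExecWhileFalse; rewrite /= ql.
    by rewrite LE cats0.
  set acc := foldl _ _ s1 in qa.
  have [t [ct le_t _]] := hs (x, acc, b).
  have {}le_t : t + w + 6 <= K x.
    rewrite /K -addnA leq_add2r (leq_trans le_t) // (leq_trans (leTs _)) // leq_mul //.
    case: (d) => // d'; rewrite leq_exp2r // !esize_pair /=.
    have := leM _ _ _ LE; rewrite -/acc LE.
    have : esize b < esize (s1 ++ b :: s2).
      elim: (s1) => [|c s1' IHs] /=; rewrite esize_cons; last lia.
      by have := esize_gt0 s2; lia.
    lia.
  have [t' [s' [ex' le_t' [qx' qa' ql']]]] : terminates body s (1 + ((t + w + 3) + 1))
     (fun s' => [/\ s' w = encode x, s' w.+1 = encode (step x acc b) & s' w.+2 = encode s2]).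
    apply: (terminates_seq (Q1 := fun s' => [/\ s' w = encode x, s' w.+2 = encode (b :: s2)
        & s' w.+3 = encode (x, acc, b)])).
      apply: terminates_assign; rewrite /update !eqxx /= qx qa ql.
      by do ![case: eqP => [?|_]; first lia].
    move=> s'' [q1 q2 q3].
    apply: (terminates_seq (Q1 := fun s' => [/\ s' w = encode x,
        s' w.+1 = encode (step x acc b) & s' w.+2 = encode (b :: s2)])).
      apply: terminates_call (q3) ct _ => //; try lia.
      by move=> s3 -> fr; rewrite !fr ?q1 ?q2 //; lia.
    move=> s3 [q4 q5 q6]; apply: terminates_assign; rewrite /update eqxx /= q4 q5 q6.
    by do ![case: eqP => [?|_]; first lia].
  have [||t2 [s2' [ex2 le_t2 q2]]] := IH (rcons s1 b) s' _ qx' _ ql'.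
  - by rewrite cat_rcons.
  - by rewrite qa' -cats1 foldl_cat.
  exists (t' + t2).+1, s2'; split=> //.
    by apply: ExecWhileTrue ex' ex2; rewrite /= ql.
  rewrite /= mulSn; lia.
move=> x; have [t0 [c0 le0 sz0]] := ha x; have [t2 [c2 le2 sz2]] := hl x.
apply: (computes_intro (T := 1 + ((t2 + w + 3) + ((t0 + w + 3) +
   ((size (L x) * K x + 1) + 1))))); last 2 first.
- have := leq_mul (ltnW (@esize_size _ eB (L x))) (leqnn (K x)); lia.
- have := leM x (L x) [::] (esym (cats0 _)); rewrite /esize; lia.
apply: (terminates_seq (Q1 := fun s => s w = encode x)).
  by apply: terminates_assign; rewrite /update eqxx.
move=> s1 q1.
apply: (terminates_seq (Q1 := fun s => s w = encode x /\ s w.+2 = encode (L x))).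
  by apply: terminates_call (q1) c2 _ => // [|s -> fr]; rewrite ?fr //; lia.
move=> s2 [q2 q2'].
apply: (terminates_seq (Q1 := fun s => [/\ s w = encode x, s w.+1 = encode (a0 x)
   & s w.+2 = encode (L x)])).
  by apply: terminates_call (q2) c0 _ => // s -> fr; rewrite !fr //; lia.
move=> s3 [q3 q3' q3''].
apply: (terminates_seq (Q1 := fun s => s w.+1 = encode (foldl (step x) (a0 x) (L x)))).
  exact: (loop x (L x) [::] s3 _ q3).
by move=> s4 q4; apply: terminates_assign; rewrite /update eqxx.
Qed.

(** * Polynomial-time functions on lists *)

Section ListFunctions.
Context X {eX : encodable X}.

Lemma polyfun_ext Y {eY : encodable Y} (f g : X -> Y) :
  f =1 g -> polyfun f -> polyfun g.
Proof. by move=> /funext ->. Qed.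

Lemma polyfun_id : polyfun (fun x : X => x).
Proof. exact: polytime_id. Qed.

Lemma polyfun_const Y {eY : encodable Y} (c : Y) : polyfun (fun _ : X => c).
Proof. exact: polytime_const. Qed.

Lemma polyfun_comp Y Z {eY : encodable Y} {eZ : encodable Z} (f : X -> Y) (g : Y -> Z) :
  polyfun f -> polyfun g -> polyfun (fun x => g (f x)).
Proof. by move=> pf pg; apply: (polytime_comp (g := fun y => encode (g y))). Qed.

Lemma polyfun_pair Y Z {eY : encodable Y} {eZ : encodable Z} (f : X -> Y) (g : X -> Z) :
  polyfun f -> polyfun g -> polyfun (fun x => (f x, g x)).
Proof. exact: polytime_node. Qed.

Lemma polyfun_fst Y Z {eY : encodable Y} {eZ : encodable Z} (f : X -> Y * Z) :
  polyfun f -> polyfun (fun x => (f x).1).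
Proof. by move=> /polytime_left. Qed.

Lemma polyfun_snd Y Z {eY : encodable Y} {eZ : encodable Z} (f : X -> Y * Z) :
  polyfun f -> polyfun (fun x => (f x).2).
Proof. by move=> /polytime_right. Qed.

Lemma polyfun_proj1 Y {eY : encodable Y} : polyfun (fst : X * Y -> X).
Proof. exact: polytime_left (@polytime_id _ _). Qed.

Lemma polyfun_proj2 Y {eY : encodable Y} : polyfun (snd : X * Y -> Y).
Proof. exact: polytime_right (@polytime_id _ _). Qed.

Lemma polyfun_if Y {eY : encodable Y} (b : X -> bool) (f g : X -> Y) :
  polyfun b -> polyfun f -> polyfun g -> polyfun (fun x => if b x then f x else g x).
Proof.
move=> pb pf pg; apply: polytime_ext (polytime_if pb pf pg) => x /=.
by case: (b x).
Qed.

Lemma polyfun_neg (b : X -> bool) : polyfun b -> polyfun (fun x => ~~ b x).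
Proof.
move=> pb; apply: polyfun_ext (polyfun_if pb (polyfun_const false) (polyfun_const true)).
by move=> x; case: (b x).
Qed.

Lemma polyfun_and (b c : X -> bool) :
  polyfun b -> polyfun c -> polyfun (fun x => b x && c x).
Proof.
move=> pb pc; apply: polyfun_ext (polyfun_if pb pc (polyfun_const false)).
by move=> x; case: (b x).
Qed.

Lemma polyfun_or (b c : X -> bool) :
  polyfun b -> polyfun c -> polyfun (fun x => b x || c x).
Proof.
move=> pb pc; apply: polyfun_ext (polyfun_if pb (polyfun_const true) pc).
by move=> x; case: (b x).
Qed.

Lemma polyfun_addb (b c : X -> bool) :
  polyfun b -> polyfun c -> polyfun (fun x => b x (+) c x).
Proof.
move=> pb pc; apply: polyfun_ext (polyfun_if pb (polyfun_neg pc) pc).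
by move=> x; case: (b x).
Qed.

Lemma polyfun_cons Y {eY : encodable Y} (f : X -> Y) (s : X -> seq Y) :
  polyfun f -> polyfun s -> polyfun (fun x => f x :: s x).
Proof. exact: polytime_node. Qed.

Lemma polyfun_behead Y {eY : encodable Y} (s : X -> seq Y) :
  polyfun s -> polyfun (fun x => behead (s x)).
Proof. by move=> /polytime_right; apply: polytime_ext => x; case: (s x). Qed.

Lemma polyfun_head Y {eY : encodable Y} (d : Y) (s : X -> seq Y) :
  polyfun s -> polyfun (fun x => head d (s x)).
Proof.
move=> ps; apply: polytime_ext (polytime_if ps (polytime_left ps) (polytime_const (encode d))).
by move=> x; case: (s x).
Qed.

Lemma polyfun_succn (n : X -> nat) : polyfun n -> polyfun (fun x => (n x).+1).
Proof. exact: (polytime_node (polytime_const Leaf)). Qed.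

Lemma polyfun_predn (n : X -> nat) : polyfun n -> polyfun (fun x => (n x).-1).
Proof. by move=> /polytime_right; apply: polytime_ext => x; case: (n x). Qed.

Lemma polyfun_nseq_false (n : X -> nat) : polyfun n -> polyfun (fun x => nseq (n x) false).
Proof. by []. Qed.

End ListFunctions.

Lemma esize_rev T {e : encodable T} (s : seq T) : esize (rev s) = esize s.
Proof.
rewrite /rev; set t : seq T := [::].
have -> : esize s = esize s + esize t - 1 by rewrite /t /= addnK.
elim: s t => [|x s IH] t /=; first by rewrite add1n subn1.
by rewrite IH !esize_cons; lia.
Qed.

Lemma esize_cat T {e : encodable T} (s t : seq T) :
  (esize (s ++ t)).+1 = esize s + esize t.
Proof. by elim: s => [|x s IH] //=; rewrite !esize_cons; lia. Qed.

Lemma esize_catl T {e : encodable T} (s t : seq T) : esize s <= esize (s ++ t).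
Proof. by rewrite -ltnS esize_cat -addn1 leq_add2l esize_gt0. Qed.

Lemma esize_catr T {e : encodable T} (s t : seq T) : esize t <= esize (s ++ t).
Proof. by rewrite -ltnS esize_cat -add1n leq_add2r esize_gt0. Qed.

Lemma esize_nat (n : nat) : esize n = n.*2.+1.
Proof. by elim: n => // n IH; have -> : esize n.+1 = (1 + esize n).+1 by []; rewrite IH. Qed.

Lemma esize_map_le T U {eT : encodable T} {eU : encodable U} (f : T -> U) N K (s : seq T) :
    (forall x, esize x <= N -> esize (f x) <= K) -> esize s <= N ->
  esize (map f s) <= (size s * K.+1).+1.
Proof.
move=> leK; elim: s => // x s IH; rewrite esize_cons => le_s.
have lex : esize x <= N by lia.
have lesN : esize s <= N by lia.
have := IH lesN; have := leK x lex.
by rewrite /= esize_cons mulSn; lia.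
Qed.

Lemma esize_filter_le T {e : encodable T} (p : pred T) (s : seq T) :
  esize (filter p s) <= esize s.
Proof. by elim: s => //= x s IH; case: ifP => _; rewrite !esize_cons; lia. Qed.

Lemma foldl_cons_if T U (p : pred T) (f : T -> U) (s : seq T) :
  foldl (fun acc x => if p x then f x :: acc else acc) [::] s = rev (map f (filter p s)).
Proof.
elim/last_ind: s => // s x IH; rewrite -cats1 foldl_cat filter_cat map_cat rev_cat IH /=.
by case: (p x).
Qed.

Section ListFunctions.
Context X Y Z {eX : encodable X} {eY : encodable Y} {eZ : encodable Z}.
Implicit Types (s t : X -> seq Y).

(** An element is no larger than its list, so a single bound depending on [x] alone serves all
    elements. *)
Lemma pbound_elements (f : X -> Y -> Z) s :
    polyfun (fun z : X * Y => f z.1 z.2) -> polyfun s ->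
  exists2 K, pbound K & forall x y, esize y <= esize (s x) -> esize (f x y) <= K x.
Proof.
move=> /pbound_polyfun [a [d le_f]] /pbound_polyfun bs.
exists (fun x => a * (esize x + esize (s x) + 1) ^ d).
  apply: pbound_mul (pbound_const a) _; apply: pbound_exp.
  by apply: pbound_add (pbound_const _); apply: pbound_add bs; apply: pbound_esize.
move=> x y le_y; apply: leq_trans (le_f (x, y)) _; rewrite leq_mul // esize_pair /=.
by case: d {le_f} => // d; rewrite leq_exp2r //; lia.
Qed.

Lemma polyfun_rev s : polyfun s -> polyfun (fun x => rev (s x)).
Proof.
move=> ps; have bs := pbound_polyfun ps.
have E l : foldl (fun acc y => y :: acc) [::] l = rev l :> seq Y.
  by rewrite (foldl_cons_if xpredT id) map_id filter_predT.
apply: (@polyfun_ext X _ _ _ (fun x => foldl (fun acc y => y :: acc) [::] (s x))) => [x|].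
  by rewrite E.
apply: (polyfun_foldl (step := fun _ acc y => y :: acc) ps _ _ bs).
- exact: polyfun_const.
- by apply: polyfun_cons; [apply: polyfun_snd|apply/polyfun_snd/polyfun_fst]; apply: polyfun_id.
- by move=> x s1 s2 sE; rewrite E esize_rev sE esize_catl.
Qed.

Lemma polyfun_has (p : X -> pred Y) s :
    polyfun (fun z : X * Y => p z.1 z.2) -> polyfun s ->
  polyfun (fun x => has (p x) (s x)).
Proof.
move=> pp ps.
apply: (@polyfun_ext X _ _ _ (fun x => foldl (fun acc y => acc || p x y) false (s x))) => [x|].
  by rewrite -[RHS]/(false || _); elim: (s x) false => [|y l IH] b /=; rewrite ?IH ?orbF ?orbA.
apply: (polyfun_foldl (step := fun x acc y => acc || p x y) ps _ _ (pbound_const 3)).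
- exact: polyfun_const.
- apply: polyfun_or; first by apply/polyfun_snd/polyfun_fst/polyfun_id.
  apply: (polyfun_comp (f := fun z : X * bool * Y => (z.1.1, z.2)) _ pp).
  by apply: polyfun_pair; [do 2!apply: polyfun_fst|apply: polyfun_snd]; apply: polyfun_id.
- by move=> x s1 s2 _; case: foldl.
Qed.

Lemma polyfun_cat s t : polyfun s -> polyfun t -> polyfun (fun x => s x ++ t x).
Proof.
move=> ps pt; have bs := pbound_polyfun ps; have bt := pbound_polyfun pt.
have E l1 l2 : foldl (fun acc y => y :: acc) l2 l1 = rev l1 ++ l2 :> seq Y.
  by elim: l1 l2 => // y l1 IH l2; rewrite /= IH rev_cons cat_rcons.
apply: (@polyfun_ext X _ _ _ (fun x => foldl (fun acc y => y :: acc) (t x) (rev (s x)))) => [x|].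
  by rewrite E revK.
apply: (polyfun_foldl (step := fun _ acc y => y :: acc) (polyfun_rev ps) pt _ (pbound_add bs bt)).
- by apply: polyfun_cons; [apply: polyfun_snd|apply/polyfun_snd/polyfun_fst]; apply: polyfun_id.
- move=> x s1 s2 sE; rewrite E.
  by rewrite (leq_trans (leqnSn _)) // esize_cat leq_add2r esize_rev -(esize_rev (s x)) sE esize_catl.
Qed.

End ListFunctions.

Lemma polyfun_pmap_if X Y Z {eX : encodable X} {eY : encodable Y} {eZ : encodable Z}
    (p : X -> pred Y) (f : X -> Y -> Z) (s : X -> seq Y) :
    polyfun (fun z : X * Y => p z.1 z.2) -> polyfun (fun z : X * Y => f z.1 z.2) ->
    polyfun s ->
  polyfun (fun x => [seq f x y | y <- s x & p x y]).
Proof.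
move=> pp pf ps; have [K bK leK] := pbound_elements pf ps; have bs := pbound_polyfun ps.
apply: (@polyfun_ext X _ _ _ (fun x => rev
   (foldl (fun acc y => if p x y then f x y :: acc else acc) [::] (s x)))) => [x|].
  by rewrite foldl_cons_if revK.
apply: polyfun_rev.
have ctx : polyfun (fun z : X * seq Z * Y => (z.1.1, z.2)).
  by apply: polyfun_pair; [do 2!apply: polyfun_fst|apply: polyfun_snd]; apply: polyfun_id.
have pacc : polyfun (fun z : X * seq Z * Y => z.1.2).
  by apply/polyfun_snd/polyfun_fst/polyfun_id.
apply: (polyfun_foldl (M := fun x => esize (s x) * (K x + 1) + 1)
   (step := fun x acc y => if p x y then f x y :: acc else acc) ps).
- exact: polyfun_const.
- apply: (polyfun_if (polyfun_comp ctx pp) _ pacc).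
  exact: polyfun_cons (polyfun_comp ctx pf) pacc.
- apply: pbound_add (pbound_const _); apply: pbound_mul (bs) _.
  exact: pbound_add (pbound_const _).
move=> x s1 s2 sE; rewrite foldl_cons_if esize_rev.
have le1 : esize [seq y <- s1 | p x y] <= esize (s x).
  by rewrite (leq_trans (esize_filter_le _ _)) // sE esize_catl.
apply: leq_trans (esize_map_le (leK x) le1) _.
rewrite addn1 ltnS addn1 leq_mul2r orbC (leq_trans _ le1) //.
exact: ltnW (esize_size _).
Qed.

Lemma polyfun_map X Y Z {eX : encodable X} {eY : encodable Y} {eZ : encodable Z}
    (f : X -> Y -> Z) (s : X -> seq Y) :
    polyfun (fun z : X * Y => f z.1 z.2) -> polyfun s ->
  polyfun (fun x => map (f x) (s x)).
Proof.
move=> pf ps.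
apply: polyfun_ext (polyfun_pmap_if (p := fun _ _ => true) (polyfun_const true) pf ps) => x.
by rewrite filter_predT.
Qed.

Lemma polyfun_filter X Y {eX : encodable X} {eY : encodable Y} (p : X -> pred Y) (s : X -> seq Y) :
    polyfun (fun z : X * Y => p z.1 z.2) -> polyfun s ->
  polyfun (fun x => filter (p x) (s x)).
Proof.
move=> pp ps.
apply: polyfun_ext (polyfun_pmap_if (f := fun _ y => y) pp _ ps) => [x /=|].
  exact: map_id.
exact/polyfun_snd/polyfun_id.
Qed.

(** * Iteration, unary arithmetic and indexing *)

Section NatFunctions.
Context X Y {eX : encodable X} {eY : encodable Y}.
Implicit Types (m n : X -> nat) (s t : X -> seq Y).

Lemma polyfun_flatten (ss : X -> seq (seq Y)) :
  polyfun ss -> polyfun (fun x => flatten (ss x)).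
Proof.
move=> ps; have bs := pbound_polyfun ps.
have E l : foldl (fun acc u => acc ++ u) [::] l = flatten l :> seq Y.
  by elim/last_ind: l => // l u IH; rewrite -cats1 foldl_cat flatten_cat /= IH cats0.
apply: (@polyfun_ext X _ _ _ (fun x => foldl (fun acc u => acc ++ u) [::] (ss x))) => [x|].
  by rewrite E.
apply: (polyfun_foldl (step := fun _ acc u => acc ++ u) ps _ _ bs).
- exact: polyfun_const.
- by apply: polyfun_cat; [apply/polyfun_snd/polyfun_fst|apply: polyfun_snd]; apply: polyfun_id.
- move=> x s1 s2 sE; rewrite E sE; apply: (@leq_trans (esize s1)).
    by elim: (s1) => //= u l IH; rewrite esize_cons (leq_trans (leqnSn _)) // esize_cat; lia.
  exact: esize_catl.
Qed.

Lemma polyfun_iter (M : X -> nat) n (a0 : X -> Y) (f : X -> Y -> Y) :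
    polyfun n -> polyfun a0 -> polyfun (fun z : X * Y => f z.1 z.2) -> pbound M ->
    (forall x k, k <= n x -> esize (iter k (f x) (a0 x)) <= M x) ->
  polyfun (fun x => iter (n x) (f x) (a0 x)).
Proof.
move=> pn pa pf bM leM.
have E x (l : seq bool) : foldl (fun acc _ => f x acc) (a0 x) l = iter (size l) (f x) (a0 x).
  by elim/last_ind: l => // l b IH; rewrite foldl_rcons IH size_rcons.
apply: (@polyfun_ext X _ _ _ (fun x => foldl (fun acc _ => f x acc) (a0 x) (nseq (n x) false))) => [x|].
  by rewrite E size_nseq.
apply: (polyfun_foldl (step := fun x acc _ => f x acc) (polyfun_nseq_false pn) pa _ bM).
- by apply: (polyfun_comp (f := fst) _ pf); apply/polyfun_fst/polyfun_id.
- move=> x s1 s2 sE; rewrite E; apply: leM.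
  by rewrite -(size_nseq (n x) false) sE size_cat leq_addr.
Qed.

End NatFunctions.

Section NatFunctions.
Context X {eX : encodable X}.
Implicit Types (m n : X -> nat).

Lemma polyfun_addn m n : polyfun m -> polyfun n -> polyfun (fun x => m x + n x).
Proof.
move=> pm pn; have bm := pbound_polyfun pm; have bn := pbound_polyfun pn.
apply: (@polyfun_ext X _ _ _ (fun x => iter (m x) succn (n x))) => [x|].
  by rewrite iter_succn addnC.
apply: (polyfun_iter (f := fun=> succn) pm pn _ (pbound_add bm bn)).
  by apply/polyfun_succn/polyfun_snd/polyfun_id.
by move=> x k le_k; rewrite iter_succn !esize_nat; lia.
Qed.

Lemma polyfun_subn m n : polyfun m -> polyfun n -> polyfun (fun x => m x - n x).
Proof.
move=> pm pn; have bm := pbound_polyfun pm.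
apply: (@polyfun_ext X _ _ _ (fun x => iter (n x) predn (m x))) => [x|].
  by rewrite iter_predn.
apply: (polyfun_iter (f := fun=> predn) pn pm _ bm).
  by apply/polyfun_predn/polyfun_snd/polyfun_id.
by move=> x k le_k; rewrite iter_predn !esize_nat; lia.
Qed.

Lemma polyfun_leq m n : polyfun m -> polyfun n -> polyfun (fun x => m x <= n x).
Proof.
move=> pm pn; have pd := polyfun_subn pm pn.
apply: polytime_ext (polytime_if pd (polytime_const (encode false)) (polytime_const (encode true))).
by move=> x /=; rewrite /leq; case: (m x - n x).
Qed.

Lemma polyfun_eqn m n : polyfun m -> polyfun n -> polyfun (fun x => m x == n x).
Proof.
move=> pm pn; apply: polyfun_ext (polyfun_and (polyfun_leq pm pn) (polyfun_leq pn pm)) => x.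
by rewrite eqn_leq.
Qed.

End NatFunctions.

Lemma polyfun_in X {eX : encodable X} (n : X -> nat) (s : X -> seq nat) : polyfun n -> polyfun s -> polyfun (fun x => n x \in s x).
Proof.
move=> pn ps; apply: polyfun_ext (polyfun_has (p := fun x (k : nat) => k == n x) _ ps) => [x|].
  by rewrite has_pred1.
apply: (polyfun_eqn (m := snd) (n := fun z => n z.1)).
  exact/polyfun_snd/polyfun_id.
by apply: polyfun_comp pn; apply/polyfun_fst/polyfun_id.
Qed.

Section IndexFunctions.
Context X Y {eX : encodable X} {eY : encodable Y}.
Implicit Types (m n : X -> nat) (s t : X -> seq Y).

Lemma polyfun_size s : polyfun s -> polyfun (fun x => size (s x)).
Proof.
move=> ps; have bs := pbound_polyfun ps.
have E l : foldl (fun acc (_ : Y) => acc.+1) 0 l = size l.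
  by elim/last_ind: l => // l u IH; rewrite foldl_rcons IH size_rcons.
apply: (@polyfun_ext X _ _ _ (fun x => foldl (fun acc (_ : Y) => acc.+1) 0 (s x))) => [x|].
  by rewrite E.
apply: (polyfun_foldl (step := fun _ acc _ => acc.+1) ps _ _ (pbound_mul (pbound_const 3) bs)).
- exact: polyfun_const.
- by apply/polyfun_succn/polyfun_snd/polyfun_fst/polyfun_id.
- move=> x s1 s2 sE; rewrite E esize_nat.
  by have := @esize_size _ eY (s x); rewrite sE size_cat; lia.
Qed.

Lemma polyfun_drop n s : polyfun n -> polyfun s -> polyfun (fun x => drop (n x) (s x)).
Proof.
move=> pn ps; have bs := pbound_polyfun ps.
have E k l : iter k behead l = drop k l :> seq Y.
  by elim: k => [|k IH] /=; rewrite ?drop0 // IH -drop1 drop_drop.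
apply: (@polyfun_ext X _ _ _ (fun x => iter (n x) behead (s x))) => [x|].
  by rewrite E.
apply: (polyfun_iter (f := fun=> behead) pn ps _ bs).
  by apply/polyfun_behead/polyfun_snd/polyfun_id.
by move=> x k _; rewrite E -{2}(cat_take_drop k (s x)) esize_catr.
Qed.

Lemma polyfun_nth (d : Y) s n :
  polyfun s -> polyfun n -> polyfun (fun x => nth d (s x) (n x)).
Proof.
move=> ps pn; apply: polyfun_ext (polyfun_head d (polyfun_drop pn ps)) => x.
by rewrite -nth0 nth_drop addn0.
Qed.

Lemma polyfun_take n s : polyfun n -> polyfun s -> polyfun (fun x => take (n x) (s x)).
Proof.
move=> pn ps; have := polyfun_drop (polyfun_subn (polyfun_size ps) pn) (polyfun_rev ps).
move/polyfun_rev; apply: polyfun_ext => x; rewrite drop_rev revK.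
have [le|lt] := leqP (n x) (size (s x)); first by rewrite subKn.
by rewrite take_oversize ?[RHS]take_oversize //; lia.
Qed.

End IndexFunctions.

Lemma polyfun_iota X {eX : encodable X} (n : X -> nat) :
  polyfun n -> polyfun (fun x => iota 0 (n x)).
Proof.
move=> pn; have bn := pbound_polyfun pn.
have E k : iter k (fun acc : seq nat => size acc :: acc) [::] = rev (iota 0 k).
  elim: k => // k IH; rewrite iterS IH size_rev size_iota -addn1 iotaD rev_cat.
  by rewrite add0n.
apply: (@polyfun_ext X _ _ _ (fun x => rev (iter (n x) (fun acc => size acc :: acc) [::]))) => [x|].
  by rewrite E revK.
apply: polyfun_rev.
apply: (polyfun_iter (f := fun _ acc => size acc :: acc)
   (M := fun x => esize (n x) * (esize (n x) + 1) + 1) pn).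
- exact: polyfun_const.
- by apply: polyfun_cons; [apply: polyfun_size|]; apply/polyfun_snd/polyfun_id.
- apply: pbound_add (pbound_const _); apply: pbound_mul (bn) _.
  exact: pbound_add (pbound_const _).
move=> x k le_k; rewrite E esize_rev esize_nat.
apply: (@leq_trans (k * (k.*2 + 2) + 1)); last nia.
elim: k {le_k} => // k IH; rewrite -addn1 iotaD.
rewrite -ltnS esize_cat esize_cons esize_nat -[esize [::]]/1 add0n; nia.
Qed.

Ltac polyfun_step :=
  lazymatch goal with
  | |- polyfun (fun x => x) => apply: polyfun_id
  | |- polyfun (fun _ => ?c) => apply: polyfun_const
  | |- polyfun fst => exact: polyfun_proj1
  | |- polyfun snd => exact: polyfun_proj2
  | |- polyfun (fun x => (_, _)) => apply: polyfun_pair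
  | |- polyfun (fun x => fst _) => apply: polyfun_fst
  | |- polyfun (fun x => snd _) => apply: polyfun_snd
  | |- polyfun (fun x => if _ then _ else _) => apply: polyfun_if
  | |- polyfun (fun x => ~~ _) => apply: polyfun_neg
  | |- polyfun (fun x => _ && _) => apply: polyfun_and
  | |- polyfun (fun x => _ || _) => apply: polyfun_or
  | |- polyfun (fun x => _ (+) _) => apply: polyfun_addb
  | |- polyfun (fun x => _ :: _) => apply: polyfun_cons
  | |- polyfun (fun x => _ ++ _) => apply: polyfun_cat
  | |- polyfun (fun x => head _ _) => apply: polyfun_head
  | |- polyfun (fun x => behead _) => apply: polyfun_behead
  | |- polyfun (fun x => rev _) => apply: polyfun_rev
  | |- polyfun (fun x => nth _ _ _) => apply: polyfun_nth
  | |- polyfun (fun x => size _) => apply: polyfun_size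
  | |- polyfun (fun x => take _ _) => apply: polyfun_take
  | |- polyfun (fun x => has _ _) => apply: polyfun_has
  | |- polyfun (fun x => map _ _) => apply: polyfun_map
  | |- polyfun (fun x => filter _ _) => apply: polyfun_filter
  | |- polyfun (fun x => flatten _) => apply: polyfun_flatten
  | |- polyfun (fun x => iota 0 _) => apply: polyfun_iota
  | |- polyfun (fun x => nseq _ false) => apply: polyfun_nseq_false
  | |- polyfun (fun x => S _) => apply: polyfun_succn
  | |- polyfun (fun x => _ + _) => apply: polyfun_addn
  | |- polyfun (fun x => _ <= _) => apply: polyfun_leq
  | |- polyfun (fun x => @eq_op Datatypes_nat__canonical__eqtype_Equality _ _) =>
      apply: polyfun_eqn
  | |- polyfun (fun x => _ \in _) => apply: polyfun_in
  end.

(* Moves a hypothesis on a function into a larger context. *)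
Ltac polyfun_var :=
  match goal with
  | H : polyfun ?f |- polyfun ?f => exact: H
  | H : polyfun ?g |- polyfun (fun x => ?g (@?p x)) =>
      apply: (polyfun_comp (f := p) (g := g) _ H)
  end.

Ltac polyfun_extra := fail.

Ltac polyfun_auto :=
  repeat first [progress cbn beta | polyfun_step | polyfun_extra | polyfun_var].

(** * Binary numbers *)

Definition bitval (s : seq bool) : nat := foldr (fun (b : bool) v => b + v.*2) 0 s.

Lemma bitval_rcons s b : bitval (rcons s b) = bitval s + 2 ^ size s * b.
Proof.
elim: s => [|c s IH] /=; first by rewrite mul1n addn0.
by rewrite IH expnS doubleD -[(2 ^ _ * _).*2]mul2n mulnA addnA.
Qed.

Lemma bitval_lt s : bitval s < 2 ^ size s.
Proof. by elim: s => //= -[] s IH; rewrite expnS; lia. Qed.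

Lemma bitval_takeS s k : bitval (take k.+1 s) = bitval (take k s) + 2 ^ k * nth false s k.
Proof.
have [lt|le] := ltnP k (size s); last by rewrite nth_default // !take_oversize //; lia.
by rewrite (take_nth false) // bitval_rcons size_take lt.
Qed.

Lemma bitval_take_lt s k : bitval (take k s) < 2 ^ k.
Proof.
apply: leq_trans (bitval_lt _) _; rewrite leq_exp2l // size_take; case: ifP => // /negbT; lia.
Qed.

Definition addbits_step (s t : seq bool) (acc : bool * seq bool) (i : nat) : bool * seq bool :=
  (nth false s i && nth false t i || acc.1 && (nth false s i || nth false t i),
   (nth false s i (+) nth false t i (+) acc.1) :: acc.2).

(** The sum is not normalised: its length depends only on the lengths of the arguments, so repeated
    addition of a fixed number grows linearly. *)
Definition addbits (s t : seq bool) : seq bool :=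
  rev (foldl (addbits_step s t) (false, [::]) (iota 0 (size s + size t).+1)).2.

Lemma foldl_iotaS T (f : T -> nat -> T) a k :
  foldl f a (iota 0 k.+1) = f (foldl f a (iota 0 k)) k.
Proof. by rewrite -addn1 iotaD foldl_cat /= add0n. Qed.

Lemma size_addbits_foldl s t l :
  size (foldl (addbits_step s t) (false, [::]) l).2 = size l.
Proof. by elim/last_ind: l => // l i IH; rewrite foldl_rcons size_rcons /= IH. Qed.

Lemma size_addbits s t : size (addbits s t) = (size s + size t).+1.
Proof. by rewrite size_rev size_addbits_foldl size_iota. Qed.

Lemma bitval_addbits s t : bitval (addbits s t) = bitval s + bitval t.
Proof.
have inv k : let acc := foldl (addbits_step s t) (false, [::]) (iota 0 k) in
    bitval (rev acc.2) + 2 ^ k * acc.1 = bitval (take k s) + bitval (take k t).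
  elim: k => [|k IH]; first by rewrite !take0.
  rewrite foldl_iotaS !bitval_takeS; set acc := foldl _ _ _ in IH *.
  have sz : size acc.2 = k by rewrite size_addbits_foldl size_iota.
  rewrite /addbits_step /= rev_cons bitval_rcons size_rev sz expnS.
  by move: IH => /=; case: acc.1 (nth false s k) (nth false t k) => [] [] [] /=; lia.
have := inv (size s + size t).+1; rewrite /= -/(addbits s t).
rewrite !take_oversize; try lia.
(* A carry out of the last position would make the sum at least 2^(size s + size t + 1), out of
   reach for numbers of these lengths. *)
case: (foldl _ _ _).1 => /= E; last by rewrite -E; lia.
have := bitval_lt s; have := bitval_lt t.
have : 2 ^ size s <= 2 ^ (size s + size t) by rewrite leq_exp2l ?leq_addr.
have : 2 ^ size t <= 2 ^ (size s + size t) by rewrite leq_exp2l ?leq_addl.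
by rewrite expnS in E; lia.
Qed.

(** The scan starts at the least significant bit, so the last differing position decides. *)
Definition leqbits (s t : seq bool) : bool :=
  foldl (fun acc i => if nth false s i (+) nth false t i then nth false t i else acc)
    true (iota 0 (size s + size t)).

Lemma leqbitsE s t : leqbits s t = (bitval s <= bitval t).
Proof.
have inv k : foldl (fun acc i => if nth false s i (+) nth false t i then nth false t i else acc)
    true (iota 0 k) = (bitval (take k s) <= bitval (take k t)).
  elim: k => [|k IH]; first by rewrite !take0.
  rewrite foldl_iotaS !bitval_takeS IH.
  have := bitval_take_lt s k; have := bitval_take_lt t k.
  by case: (nth false s k) (nth false t k) => [] [] /=; lia.
by rewrite /leqbits inv !take_oversize //; lia.
Qed.

(** The multiplier is unary, which makes repeated addition polynomial. This suffices: numerator and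
    denominator of [f] are only multiplied by numbers of items. *)
Definition mulbits (n : nat) (s : seq bool) : seq bool := iter n (addbits s) [::].

Lemma bitval_mulbits n s : bitval (mulbits n s) = n * bitval s.
Proof. by elim: n => // n IH; rewrite [mulbits _ _]iterS bitval_addbits IH mulSn. Qed.

Definition natbits (n : nat) : seq bool :=
  if bin_of_nat n is BinNums.Npos p then bits_of_pos p else [::].

Lemma natbitsK n : bitval (natbits n) = n.
Proof.
rewrite -[RHS]bin_of_natK /natbits; case: (bin_of_nat n) => //= p.
by elim: p => //= p ->; rewrite ?NatTrec.doubleE.
Qed.

(** The budgets of high levels are exponential, but their binary codes can be written directly from
    the unary level. *)
Lemma natbits_exp2 j : natbits (2 ^ j) = rcons (nseq j false) true.
Proof.
pose p := iter j BinNums.xO BinNums.xH.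
have -> : 2 ^ j = nat_of_bin (BinNums.Npos p).
  by rewrite {}/p /=; elim: j => //= j IH; rewrite expnS IH NatTrec.doubleE mul2n.
by rewrite /natbits nat_of_binK {}/p; elim: j => //= j ->.
Qed.

Lemma esize_bits (s : seq bool) : esize s <= 4 * size s + 1.
Proof.
elim: s => //= b s IH; rewrite esize_cons.
have : esize b <= 3 by case: b.
lia.
Qed.

Section BinaryPolyfun.
Context X {eX : encodable X}.
Implicit Types (s t : X -> seq bool).

Lemma polyfun_addbits s t :
  polyfun s -> polyfun t -> polyfun (fun x => addbits (s x) (t x)).
Proof.
move=> ps pt; have bs := pbound_polyfun ps; have bt := pbound_polyfun pt.
apply/polyfun_rev/polyfun_snd.
apply: (polyfun_foldl (L := fun x => iota 0 (size (s x) + size (t x)).+1)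
  (a0 := fun=> (false, [::])) (step := fun x => addbits_step (s x) (t x))
  (M := fun x => 4 * (esize (s x) + esize (t x)) + 10)).
- polyfun_auto.
- polyfun_auto.
- rewrite /addbits_step; polyfun_auto.
- apply: pbound_add (pbound_const _); apply: pbound_mul (pbound_const 4) _.
  exact: pbound_add.
move=> x s1 s2 E.
have := congr1 size E; rewrite size_iota size_cat => lens.
rewrite esize_pair (leq_trans (n := (3 + (4 * size s1 + 1)).+1)) //.
  rewrite ltnS leq_add //; first by case: (foldl _ _ _).1.
  by rewrite -(size_addbits_foldl (s x) (t x)) esize_bits.
have les : size (s x) < esize (s x) by apply: esize_size.
have let_ : size (t x) < esize (t x) by apply: esize_size.
lia.
Qed.

Lemma polyfun_leqbits s t :
  polyfun s -> polyfun t -> polyfun (fun x => leqbits (s x) (t x)).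
Proof.
move=> ps pt.
apply: (polyfun_foldl (L := fun x => iota 0 (size (s x) + size (t x))) (a0 := fun=> true)
  (step := fun x acc i => if nth false (s x) i (+) nth false (t x) i then nth false (t x) i else acc)
  (M := fun=> 3)).
- polyfun_auto.
- polyfun_auto.
- polyfun_auto.
- exact: pbound_const.
- by move=> x s1 s2 _; case: foldl.
Qed.

End BinaryPolyfun.

Lemma polyfun_mulbits X {eX : encodable X} (n : X -> nat) (s : X -> seq bool) :
  polyfun n -> polyfun s -> polyfun (fun x => mulbits (n x) (s x)).
Proof.
move=> pn ps; have bn := pbound_polyfun pn; have bs := pbound_polyfun ps.
apply: (polyfun_iter (f := fun x => addbits (s x)) (a0 := fun=> [::])
  (M := fun x => 4 * (esize (n x) * esize (s x)) + 1) pn).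
- polyfun_auto.
- by apply: polyfun_addbits; polyfun_auto.
- apply: pbound_add (pbound_const _); apply: pbound_mul (pbound_const 4) _.
  exact: pbound_mul.
move=> x k le_k; apply: leq_trans (esize_bits _) _; rewrite leq_add2r leq_mul2l /=.
have -> : size (iter k (addbits (s x)) [::]) = k * (size (s x)).+1.
  by elim: k {le_k} => // k IH; rewrite iterS size_addbits IH mulSn.
by rewrite leq_mul // ?esize_size // esize_nat; lia.
Qed.

(** * The algorithm *)

#[export] Instance encodable_instance : encodable instance := enc_instance.
#[export] Instance encodable_rat : encodable rat :=
  fun f => Node (enc_nat `|numq f|%N) (enc_nat `|denq f|%N).

Definition rows (I : instance) : seq (seq bool) :=
  [seq [seq x \in member i | x <- enum 'I_(items I)] | i <- enum 'I_(sets I)].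

Definition order_rows (I : instance) : seq (seq bool) :=
  [seq [seq prec i j | j <- enum 'I_(sets I)] | i <- enum 'I_(sets I)].

Lemma enc_seq_map T U (e : U -> tree) (f : T -> U) (s : seq T) :
  enc_seq e (map f s) = enc_seq (fun x => e (f x)) s.
Proof. by elim: s => //= x s ->. Qed.

Lemma eq_enc_seq T (e e' : T -> tree) : e =1 e' -> enc_seq e =1 enc_seq e'.
Proof. by move=> eE; elim=> //= x s ->; rewrite eE. Qed.

Lemma encode_matrix m n (a : 'I_m -> 'I_n -> bool) :
  encode [seq [seq a i j | j <- enum 'I_n] | i <- enum 'I_m] =
  enc_seq (fun i => enc_bitvec (a i)) (enum 'I_m).
Proof.
rewrite /encode /encodable_seq enc_seq_map; apply: eq_enc_seq => i.
by rewrite enc_seq_map.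
Qed.

Lemma encode_instanceE I : encode I = Node (encode (rows I)) (encode (order_rows I)).
Proof. by rewrite !encode_matrix. Qed.

Lemma size_rows I : size (rows I) = sets I.
Proof. by rewrite size_map size_enum_ord. Qed.

(** The encoding stores no universe size; the first row reveals it. Without sets there is no row,
    but then the cover condition forces an empty universe. *)
Lemma items_rows I : items I = size (head [::] (rows I)).
Proof.
case: I => n [|m] mem prc cover refl anti trans; rewrite /rows /=.
  rewrite enum_ord0 /=; case: n mem cover => // n mem cover.
  have : ord0 \in \bigcup_i mem i by rewrite cover inE.
  by case/bigcupP => -[].
by rewrite enum_ordSl /= size_map size_enum_ord.
Qed.

(* Sets and items are handled as natural numbers; numbers that are too large
   denote the empty set and uncovered items. *)
Definition incident (I : instance) (i x : nat) : bool := nth false (nth [::] (rows I) i) x.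

Definition precedes (I : instance) (i j : nat) : bool :=
  nth false (nth [::] (order_rows I) i) j.

Lemma nth_matrix m n (a : 'I_m -> 'I_n -> bool) (i : 'I_m) (j : 'I_n) :
  nth false (nth [::] [seq [seq a i j | j <- enum 'I_n] | i <- enum 'I_m] i) j = a i j.
Proof.
rewrite (nth_map i) ?size_enum_ord // (nth_map j) ?size_enum_ord //.
by rewrite !nth_ord_enum.
Qed.

Lemma incidentE I (i : 'I_(sets I)) (x : 'I_(items I)) : incident I i x = (x \in member i).
Proof. exact: nth_matrix. Qed.

Lemma precedesE I (i j : 'I_(sets I)) : precedes I i j = prec i j.
Proof. exact: (nth_matrix (@prec I)). Qed.

Section Algorithm.
Variables (oracle : instance * nat -> seq bool) (t : nat).
Implicit Types (I : instance) (p : instance * rat) (s : seq nat).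

Definition covers I s (x : nat) : bool := has (fun i => incident I i x) s.

Definition coverage I s : nat := size [seq x <- iota 0 (items I) | covers I s x].

(** The inequality [f * n <= coverage] with the denominator cleared, hence a comparison of
    integers. *)
Definition on_target p s : bool :=
  leqbits (mulbits (items p.1) (natbits `|numq p.2|%N))
          (mulbits (coverage p.1 s) (natbits `|denq p.2|%N)).

Definition finisher p s (i : nat) : bool := on_target p (i :: s).

Definition blocked p s (i : nat) : bool :=
  has (fun j => finisher p s j && precedes p.1 j i) (iota 0 (sets p.1)).

(** The second condition serves [member_cover]: an instance has no item outside all its sets, so
    items met only by blocked sets are dropped. *)
Definition residual_item p s (x : nat) : bool :=
  ~~ covers p.1 s x &&
  has (fun i => ~~ blocked p s i && incident p.1 i x) (iota 0 (sets p.1)).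

Definition residual_items p s : seq 'I_(items p.1) :=
  [seq x : 'I_(items p.1) <- enum 'I_(items p.1) | residual_item p s x].

(** Blocked sets are emptied instead of removed. Index set and order stay the same, and an answer
    for the residual instance is literally a family of the original one. *)
Definition residual_member p s (i : 'I_(sets p.1)) : {set 'I_(size (residual_items p s))} :=
  [set y | ~~ blocked p s i && (tnth (in_tuple (residual_items p s)) y \in member i)].

Lemma residual_cover p s : \bigcup_i @residual_member p s i = [set: _].
Proof.
apply/setP=> y; rewrite !inE; apply/bigcupP.
have := mem_tnth y (in_tuple (residual_items p s)); set x := tnth _ y.
rewrite mem_filter => /andP[/andP[_ /hasP[i]]].
rewrite mem_iota add0n => /andP[_ lt_i] /andP[unblocked incix] _.
by exists (Ordinal lt_i) => //; rewrite inE unblocked -incidentE.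
Qed.

Definition residual p s : instance :=
  Instance (residual_cover p s) (@prec_refl p.1) (@prec_anti p.1) (@prec_trans p.1).

Lemma encode_residual p s :
  encode (residual p s) =
  Node (encode [seq [seq ~~ blocked p s i && incident p.1 i x
                    | x <- [seq x <- iota 0 (items p.1) | residual_item p s x]]
               | i <- iota 0 (sets p.1)])
       (encode (order_rows p.1)).
Proof.
rewrite encode_instanceE; congr Node; congr encode.
rewrite -(val_enum_ord (sets p.1)) -map_comp /rows /=; apply: eq_map => i /=.
rewrite -(val_enum_ord (items p.1)) filter_map -map_comp.
have -> : [seq x <- enum 'I_(items p.1) | preim val (residual_item p s) x] =
    residual_items p s by [].
transitivity (map (fun x => ~~ blocked p s i && incident p.1 i (val x))
    (map (tnth (in_tuple (residual_items p s))) (enum 'I_(size (residual_items p s))))).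
  by rewrite -[RHS]map_comp; apply: eq_map => y; rewrite /= inE incidentE.
by rewrite (map_tnth_enum (in_tuple (residual_items p s))).
Qed.

(* Listing the sets by the number of their predecessors extends the partial order. *)
Definition down_size I (i : nat) : nat := size [seq j <- iota 0 (sets I) | precedes I j i].

Definition linear_order I : seq nat :=
  flatten [seq [seq i <- iota 0 (sets I) | down_size I i == c] | c <- iota 0 (sets I).+1].

(** * Polynomial running time of the algorithm *)

Section InstancePolyfun.
Context X {eX : encodable X}.

Lemma polyfun_rows (I : X -> instance) : polyfun I -> polyfun (fun x => rows (I x)).
Proof. by move=> /polytime_left; apply: polytime_ext => x; rewrite encode_instanceE. Qed.

Lemma polyfun_order_rows (I : X -> instance) :
  polyfun I -> polyfun (fun x => order_rows (I x)).
Proof. by move=> /polytime_right; apply: polytime_ext => x; rewrite encode_instanceE. Qed.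

Lemma polyfun_sets (I : X -> instance) : polyfun I -> polyfun (fun x => sets (I x)).
Proof.
move=> /polyfun_rows/polyfun_size; apply: polyfun_ext => x; exact: size_rows.
Qed.

Lemma polyfun_items (I : X -> instance) : polyfun I -> polyfun (fun x => items (I x)).
Proof.
move=> /polyfun_rows/(polyfun_head [::])/polyfun_size.
by apply: polyfun_ext => x; rewrite items_rows.
Qed.

Lemma polyfun_numerator (f : X -> rat) :
  polyfun f -> polyfun (fun x => natbits `|numq (f x)|).
Proof. by move=> /polytime_left. Qed.

Lemma polyfun_denominator (f : X -> rat) :
  polyfun f -> polyfun (fun x => natbits `|denq (f x)|).
Proof. by move=> /polytime_right. Qed.

End InstancePolyfun.

Ltac polyfun_extra ::=
  lazymatch goal with
  | |- polyfun (fun x => rows _) => apply: polyfun_rows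
  | |- polyfun (fun x => order_rows _) => apply: polyfun_order_rows
  | |- polyfun (fun x => sets _) => apply: polyfun_sets
  | |- polyfun (fun x => items _) => apply: polyfun_items
  | |- polyfun (fun x => natbits (absz (numq _))) => apply: polyfun_numerator
  | |- polyfun (fun x => natbits (absz (denq _))) => apply: polyfun_denominator
  | |- polyfun (fun x => leqbits _ _) => apply: polyfun_leqbits
  | |- polyfun (fun x => mulbits _ _) => apply: polyfun_mulbits
  end.

(** Blocked sets, still members of the residual family, may be returned by the oracle and are
    discarded here. Filtering [linear_order] lists the new sets in an admissible order. *)
Definition greedy_round p s (j : nat) : seq nat :=
  s ++ [seq i <- linear_order p.1 |
         nth false (oracle (residual p s, 2 ^ j)) i && (~~ blocked p s i && ~~ (i \in s))].

Definition levels I : seq nat :=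
  flatten [seq nseq t j | j <- iota 0 (items I + sets I + 4)].

Definition states p : seq (seq nat) :=
  foldl (fun h j => greedy_round p (head [::] h) j :: h) [:: [::]] (levels p.1).

Definition add_down I s (i : nat) : seq nat :=
  s ++ [seq j <- linear_order I | precedes I j i && ~~ (j \in s)].

Definition candidates p : seq (seq nat) :=
  states p ++
  flatten [seq [seq add_down p.1 s i | i <- iota 0 (sets p.1)] | s <- states p].

(** Being off target passes to shorter prefixes, so the number of prefixes off target is the length
    at which the target is first met. A sequence that never meets it is kept whole. *)
Definition truncate p s : seq nat :=
  take (size [seq k <- iota 0 (size s) | ~~ on_target p (take k s)]) s.

(** The cover time as the length of a list: a covered item occurs once for each proper prefix that
    misses it, which is its coverage time. *)
Definition cost I s : nat :=
  size (flatten [seq [seq k <- iota 0 (size s) | ~~ covers I (take k s) x]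
                | x <- [seq x <- iota 0 (items I) | covers I s x]]).

Definition choose_better p acc s : seq nat :=
  if on_target p s && (cost p.1 (truncate p s) <= cost p.1 acc) then truncate p s else acc.

(** The starting value is feasible because all sets together cover the universe, so the result meets
    the target whatever the candidates are. *)
Definition best_candidate p : seq nat :=
  foldl (choose_better p) (truncate p (linear_order p.1)) (candidates p).

(** Stated for composed queries: a program only has to produce the code of the query, and only a
    positive budget carries a guarantee. *)
Hypothesis polyfun_oracle : forall X (eX : encodable X) (g : X -> instance * nat),
  (forall x, 0 < (g x).2) -> polytime (fun x => enc_bpcsc (g x)) ->
  polyfun (fun x => oracle (g x)).

Section AlgorithmPolyfun.
Context X {eX : encodable X}.
Variables (p : X -> instance * rat) (s : X -> seq nat).
Hypotheses (polyfun_p : polyfun p) (polyfun_s : polyfun s).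

Lemma polyfun_on_target : polyfun (fun x => on_target (p x) (s x)).
Proof. by rewrite /on_target /coverage /covers /incident; polyfun_auto. Qed.

Lemma polyfun_linear_order : polyfun (fun x => linear_order (p x).1).
Proof. by rewrite /linear_order /down_size /precedes; polyfun_auto. Qed.

Lemma polyfun_cost : polyfun (fun x => cost (p x).1 (s x)).
Proof. by rewrite /cost /covers /incident; polyfun_auto. Qed.

Lemma polyfun_levels : polyfun (fun x => levels (p x).1).
Proof.
have polyfun_nseq : polyfun (fun z : X * nat => nseq t z.2).
  by elim: t => [|k IH] /=; polyfun_auto.
by apply: polyfun_flatten; apply: polyfun_map; polyfun_auto.
Qed.

End AlgorithmPolyfun.

Section AlgorithmPolyfun.
Context X {eX : encodable X}.
Variables (p : X -> instance * rat) (s : X -> seq nat).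
Hypotheses (polyfun_p : polyfun p) (polyfun_s : polyfun s).

Lemma polyfun_blocked i : polyfun i -> polyfun (fun x => blocked (p x) (s x) (i x)).
Proof.
move=> pi; rewrite /blocked /finisher /precedes; polyfun_auto.
by apply: polyfun_on_target; polyfun_auto.
Qed.

Lemma polyfun_truncate : polyfun (fun x => truncate (p x) (s x)).
Proof.
rewrite /truncate; polyfun_auto.
by apply: polyfun_on_target; polyfun_auto.
Qed.

Lemma polyfun_add_down i : polyfun i -> polyfun (fun x => add_down (p x).1 (s x) (i x)).
Proof.
move=> pi; have po := polyfun_linear_order polyfun_p.
by rewrite /add_down /precedes; apply: polyfun_cat => //; apply: polyfun_filter po; polyfun_auto.
Qed.

End AlgorithmPolyfun.

Section AlgorithmPolyfun.
Context X {eX : encodable X}.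
Variables (p : X -> instance * rat) (s : X -> seq nat).
Hypotheses (polyfun_p : polyfun p) (polyfun_s : polyfun s).

Lemma polyfun_greedy_round j :
  polyfun j -> polyfun (fun x => greedy_round (p x) (s x) (j x)).
Proof.
move=> pj; have po := polyfun_linear_order polyfun_p.
have pC : polyfun (fun x => oracle (residual (p x) (s x), 2 ^ j x)).
  apply: polyfun_oracle => [x|]; first by rewrite expn_gt0.
  apply: (@polytime_ext X _ (fun x => Node (encode (residual (p x) (s x)))
     (encode (nseq (j x) false ++ [:: true])))) => [x|].
    by rewrite cats1 -natbits_exp2.
  apply: polytime_node; last by rewrite -/(polyfun _); polyfun_auto.
  apply: polytime_ext (fun x => esym (encode_residual (p x) (s x))) _.
  apply: polytime_node; last by rewrite -/(polyfun _); polyfun_auto.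
  rewrite -/(polyfun _) /residual_item /covers /incident; polyfun_auto;
    by apply: polyfun_blocked; polyfun_auto.
have aux (C : X -> seq bool) : polyfun C -> polyfun (fun x => s x ++ [seq i <- linear_order (p x).1 |
      nth false (C x) i && (~~ blocked (p x) (s x) i && ~~ (i \in s x))]).
  move=> {}pC; apply: polyfun_cat => //; apply: polyfun_filter po; polyfun_auto.
  by apply: polyfun_blocked; polyfun_auto.
exact: aux pC.
Qed.

End AlgorithmPolyfun.

(** Whatever the oracle answers, a round appends a sublist of [linear_order]; states therefore grow
    by at most its size per round. *)
Lemma esize_states_foldl p l :
  let h := foldl (fun h j => greedy_round p (head [::] h) j :: h) [:: [::]] l in
  let K := esize (linear_order p.1) in
  esize (head [::] h) <= size l * K + 1 /\
  esize h <= (size l + 1) * (size l * K + 2) + 1.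
Proof.
set K := esize _; elim/last_ind: l => [|l j /= [IH1 IH2]]; first by [].
rewrite foldl_rcons size_rcons /=; set h := foldl _ _ l in IH1 IH2 *.
have le1 : esize (greedy_round p (head [::] h) j) <= (size l).+1 * K + 1.
  rewrite -ltnS esize_cat; apply: (@leq_trans (size l * K + 1 + K)); last by rewrite mulSn; lia.
  by rewrite leq_add // esize_filter_le.
split=> //; rewrite esize_cons; nia.
Qed.

Lemma polyfun_states : polyfun states.
Proof.
have pl := @polyfun_levels _ _ id (@polyfun_id _ _).
have po := @polyfun_linear_order _ _ id (@polyfun_id _ _).
have bl := pbound_polyfun pl; have bo := pbound_polyfun po.
apply: (polyfun_foldl (L := fun p => levels p.1) (a0 := fun=> [:: [::]])
  (step := fun p h j => greedy_round p (head [::] h) j :: h)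
  (M := fun p => (esize (levels p.1) + 1) *
     (esize (levels p.1) * esize (linear_order p.1) + 2) + 1) pl).
- exact: polyfun_const.
- by apply: polyfun_cons; [apply: polyfun_greedy_round|]; polyfun_auto.
- apply: pbound_add (pbound_const _); apply: pbound_mul.
    exact: pbound_add (pbound_const _).
  by apply: pbound_add (pbound_const _); apply: pbound_mul.
move=> p s1 s2 E; have [_] := esize_states_foldl p s1.
have : size s1 <= esize (levels p.1).
  by apply: leq_trans (ltnW (esize_size _)); rewrite E size_cat leq_addr.
by move=> le1 le2; apply: leq_trans le2 _; rewrite leq_add2r leq_mul ?leq_add2r // leq_mul.
Qed.

Lemma polyfun_candidates : polyfun candidates.
Proof.
have ps := polyfun_states; apply: polyfun_cat => //; apply: polyfun_flatten.
apply: polyfun_map ps; apply: polyfun_map; last by polyfun_auto.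
by apply: polyfun_add_down; polyfun_auto.
Qed.

Lemma polyfun_best_candidate : polyfun best_candidate.
Proof.
have pc := polyfun_candidates; have bc := pbound_polyfun pc.
have po := @polyfun_linear_order _ _ id (@polyfun_id _ _); have bo := pbound_polyfun po.
have le_truncate p s : esize (truncate p s) <= esize s.
  by rewrite -{2}(cat_take_drop (size [seq k <- iota 0 (size s) | ~~ on_target p (take k s)]) s) esize_catl.
apply: (polyfun_foldl (L := candidates) (a0 := fun p => truncate p (linear_order p.1))
  (step := choose_better) pc _ _ (pbound_add bo bc)).
- exact: polyfun_truncate (@polyfun_id _ _) po.
- apply: polyfun_if; last by polyfun_auto.
    apply: polyfun_and; first by apply: polyfun_on_target; polyfun_auto.
    apply: polyfun_leq; apply: polyfun_cost; polyfun_auto.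
    by apply: polyfun_truncate; polyfun_auto.
  by apply: polyfun_truncate; polyfun_auto.
(* The accumulator is always a truncation of the starting sequence or of a candidate already
   read. *)
move=> p s1 s2 E; apply: (@leq_trans (esize (linear_order p.1) + esize s1)).
  have := le_truncate p (linear_order p.1).
  elim: s1 (truncate p _) (esize (linear_order p.1)) {E} => [|c l IH] acc k le_k /=.
    exact: leq_trans (leq_addr _ _).
  rewrite esize_cons -addSn addnA; apply: IH; rewrite /choose_better.
  by have := le_truncate p c; case: ifP; lia.
by rewrite E leq_add2l esize_catl.
Qed.

End Algorithm.

(** * Analysis of the greedy sequence *)

(** The prefixes without a hit are those no longer than the index of the first hit. Counting them,
    including the empty one, yields a position counted from 1. *)
Lemma size_unhit_prefixes T (a : pred T) s :
  has a s -> size [seq k <- iota 0 (size s) | ~~ has a (take k s)] = (find a s).+1.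
Proof.
move=> has_s; have lt_find : find a s < size s by rewrite -has_find.
rewrite (eq_filter (a2 := fun k => k < (find a s).+1)); last first.
  by move=> k; rewrite /= has_take // -leqNgt ltnS.
rewrite -{1}(subnKC lt_find) iotaD filter_cat size_cat add0n.
rewrite (_ : filter _ (iota _.+1 _) = [::]) ?addn0.
  by rewrite size_filter (@eq_in_count _ _ xpredT) ?count_predT ?size_iota // => k;
    rewrite mem_iota add0n => /andP[_ ->].
rewrite (@eq_in_filter _ _ pred0) ?filter_pred0 // => k.
by rewrite mem_iota => /andP[+ _]; rewrite leqNgt => /negPf ->.
Qed.

Section Coverage.
Variable I : instance.
Implicit Types (s : seq 'I_(sets I)) (x : 'I_(items I)) (i : 'I_(sets I)).

Lemma in_seq_cov s x : (x \in seq_cov s) = has (fun i => x \in member i) s.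
Proof.
apply/bigcupP/hasP => [[i] | [i s_i x_i]]; first by rewrite inE => s_i x_i; exists i.
by exists i; rewrite ?inE.
Qed.

Lemma seq_cov_sub s s' : {subset s <= s'} -> seq_cov s \subset seq_cov s'.
Proof.
move=> sub; apply/subsetP=> x; rewrite !in_seq_cov => /hasP[i /sub s_i x_i].
by apply/hasP; exists i.
Qed.

Lemma seq_cov_cat s s' : seq_cov (s ++ s') = seq_cov s :|: seq_cov s'.
Proof. by apply/setP=> x; rewrite inE !in_seq_cov has_cat. Qed.

Lemma seq_cov_cons i s : seq_cov (i :: s) = member i :|: seq_cov s.
Proof. by apply/setP=> x; rewrite inE !in_seq_cov. Qed.

Lemma seq_cov_take s k l : k <= l -> seq_cov (take k s) \subset seq_cov (take l s).
Proof.
move=> le_kl; apply: seq_cov_sub => i; rewrite -(take_takel _ le_kl); exact: mem_take.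
Qed.

(** Double counting: each item of the final cover is charged once per proper prefix that misses it,
    and the two sums are exchanged. *)
Lemma cover_timeE s :
  cover_time s = \sum_(k < size s) (#|seq_cov s| - #|seq_cov (take k s)|).
Proof.
have timeE x : x \in seq_cov s ->
    coverage_time s x = \sum_(k < size s) (x \notin seq_cov (take k s)).
  move=> s_x; rewrite /coverage_time s_x; rewrite in_seq_cov in s_x.
  have lt_find : find (fun i => x \in member i) s < size s by rewrite -has_find.
  rewrite -size_unhit_prefixes // size_filter -sum1_count /=.
  rewrite -[in LHS](subn0 (size s)) -/(index_iota 0 (size s)) big_mkord big_mkcond /=.
  by apply: eq_bigr => k _; rewrite in_seq_cov; case: has.
rewrite /cover_time (eq_bigr _ timeE) exchange_big /=; apply: eq_bigr => k _.
have sub : seq_cov (take k s) \subset seq_cov s.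
  by apply: seq_cov_sub => i; apply: mem_take.
rewrite -big_mkcondr sum1_card -cardsDS //.
by apply: eq_card => x; rewrite !inE andbC.
Qed.

Lemma seq_cov_le_cover_time s : #|seq_cov s| <= cover_time s.
Proof.
rewrite -sum1_card; apply: leq_sum => x s_x; rewrite /coverage_time s_x; by [].
Qed.

Lemma cover_time_le s : cover_time s <= items I * size s.
Proof.
rewrite /cover_time (@leq_trans (\sum_(x in seq_cov s) size s)) //.
  apply: leq_sum => x s_x; rewrite /coverage_time s_x -has_find -in_seq_cov //.
by rewrite sum_nat_const leq_mul // -[leqRHS]card_ord max_card.
Qed.

(** Cauchy condensation. The number of missing items decreases with the prefix length, so the term
    of 2^j is paid by twice the terms of lengths from 2^(j-1) to 2^j - 1, and the term j = 0 by the
    empty prefix. *)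
Lemma dyadic_cover_time s J :
  \sum_(j < J) 2 ^ j * (#|seq_cov s| - #|seq_cov (take (2 ^ j) s)|) <= 2 * cover_time s.
Proof.
pose u k := #|seq_cov s| - #|seq_cov (take k s)|.
have u_anti k l : k <= l -> u l <= u k.
  by move=> le_kl; rewrite leq_sub2l // subset_leq_card // seq_cov_take.
have le_sum M : \sum_(0 <= k < M) u k <= cover_time s.
  rewrite cover_timeE -(big_mkord xpredT u) /=.
  have [le|lt] := leqP M (size s).
    by rewrite (big_cat_nat _ le) //= leq_addr.
  rewrite (big_cat_nat _ (ltnW lt)) //= (_ : \sum_(size s <= k < M) u k = 0) ?addn0 //.
  by rewrite big_nat_cond big1 // => k /andP[/andP[le_k _] _]; rewrite /u take_oversize ?subnn.
case: J => [|J]; first by rewrite big_ord0.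
apply: leq_trans (leq_mul (leqnn 2) (le_sum (2 ^ J))).
elim: J => [|J IH].
  rewrite big_ord_recl big_ord0 big_nat1 addn0 expn0 mul1n -/(u 1).
  by have := u_anti 0 1 isT; lia.
have le2 : 2 ^ J <= 2 ^ J.+1 by rewrite leq_exp2l.
rewrite big_ord_recr /= (big_cat_nat _ le2) //=.
rewrite mulnDr leq_add // -/(u _) expnS -mulnA leq_mul2l /=.
rewrite (@leq_trans (\sum_(2 ^ J <= k < 2 * 2 ^ J) u (2 * 2 ^ J))) //.
  rewrite sum_nat_const_nat leq_mul2r; apply/orP; right; lia.
by rewrite big_nat_cond [leqRHS]big_nat_cond; apply: leq_sum => k; rewrite andbT => /andP[_ /ltnW/u_anti].
Qed.

End Coverage.

Lemma prec_closed_take (I : instance) (s : seq 'I_(sets I)) k :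
  prec_closed_seq s -> prec_closed [set i in take k s].
Proof.
case/and3P=> _ /forall_inP closed /forall_inP ordered.
apply/forall_inP=> i; rewrite !inE => s_i; have s_i' := mem_take s_i.
apply/forallP=> j; apply/implyP=> ji; rewrite inE.
have s_j : j \in s.
  by move: (closed i); rewrite inE => /(_ s_i')/forallP/(_ j); rewrite ji inE.
have [<- //|ne_ji] := eqVneq i j.
rewrite in_take //; rewrite in_take // in s_i; apply: ltn_trans s_i.
by have /forall_inP/(_ i s_i') := ordered j s_j; rewrite eq_sym ne_ji ji.
Qed.

Lemma prec_closed_seq_size (I : instance) (s : seq 'I_(sets I)) :
  prec_closed_seq s -> size s <= sets I.
Proof. by case/and3P=> /card_uniqP <- _ _; rewrite -[leqRHS]card_ord max_card. Qed.

(** * Cover time of greedy states against an optimal sequence *)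

Section Greedy.
Variables (I : instance) (N A t : nat).
Variables (st d : nat -> seq 'I_(sets I)) (opt : seq 'I_(sets I)).
Local Notation cv s := #|seq_cov s|.

Hypotheses (N_gt0 : 0 < N) (A_gt0 : 0 < A) (t_gt0 : 0 < t).
Hypotheses (st0 : st 0 = [::]) (stS : forall r, st r.+1 = st r ++ d r).
Hypothesis size_d : forall r, size (d r) <= A * 2 ^ (r %/ t).
Hypothesis d_nonfinisher : forall r i, i \in d r -> cv (i :: st r) < N.
Hypothesis gain : forall r (O : {set 'I_(sets I)}),
  prec_closed O -> #|O| <= 2 ^ (r %/ t) -> (forall i, i \in O -> cv (i :: st r) < N) ->
  3 * #|cov O :\: seq_cov (st r)| <= t * (cv (st r.+1) - cv (st r)).
Hypotheses (opt_closed : prec_closed_seq opt) (opt_covers : N <= cv opt).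

Let F := cv opt.
Let top j := take (2 ^ j) opt.
Let u j := F - cv (top j).
Let sigma j := F - cv (st (t * j)).

(** Before the first event every set in the prefix [top (r %/ t)] is a nonfinisher, so [gain]
    applies to that prefix. *)
Let event r := (N <= cv (st r.+1)) || has (fun i => N <= cv (i :: st r)) (top (r %/ t)).

Lemma sub_st q r : q <= r -> {subset st q <= st r}.
Proof.
move=> /subnKC <-; elim: (r - q) => [|k IH] i; first by rewrite addn0.
by move=> /IH; rewrite addnS stS mem_cat => ->.
Qed.

Lemma cov_st q r : q <= r -> seq_cov (st q) \subset seq_cov (st r).
Proof. by move=> /sub_st; apply: seq_cov_sub. Qed.

Lemma cv_st q r : q <= r -> cv (st q) <= cv (st r).
Proof. by move=> /cov_st/subset_leq_card. Qed.

Lemma level_round j i : i < t -> (t * j + i) %/ t = j.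
Proof. by move=> lt_it; rewrite mulnC divnMDl // divn_small ?addn0. Qed.

(** Measured at the end of level [j], hence a lower bound on what the prefix still offers in every
    round of the level. *)
Definition left_over j := #|seq_cov (top j) :\: seq_cov (st (t * j.+1))|.

(** Each of the [t] rounds gains at least a fraction 3/t of what the prefix offers, hence of
    [left_over j]; the rounds add up. *)
Lemma level_gain j : (forall r, t * j <= r < t * j.+1 -> ~~ event r) ->
  3 * left_over j + cv (st (t * j)) <= cv (st (t * j.+1)).
Proof.
move=> no_event; have gain_i i : i <= t ->
    i * (3 * left_over j) <= t * (cv (st (t * j + i)) - cv (st (t * j))).
  elim: i => [|i IH] lt_it //; have {}IH := IH (ltnW lt_it).
  have in_level : t * j <= t * j + i < t * j.+1 by rewrite mulnSr; lia.
  have lev := level_round j lt_it.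
  have := no_event _ in_level; rewrite /event lev negb_or => /andP[_ /hasPn nofin].
  have := @gain (t * j + i) [set i in top j].
  rewrite lev prec_closed_take // => /(_ isT) gainO.
  have {gainO} : 3 * #|seq_cov (top j) :\: seq_cov (st (t * j + i))| <=
      t * (cv (st (t * j + i).+1) - cv (st (t * j + i))).
    apply: gainO.
      by rewrite cardsE (leq_trans (card_size _)) // size_take_min geq_minl.
    by move=> k; rewrite inE => /nofin; rewrite -ltnNge.
  have : left_over j <= #|seq_cov (top j) :\: seq_cov (st (t * j + i))|.
    by rewrite subset_leq_card // setDS // cov_st // mulnSr; lia.
  have := @cv_st (t * j) (t * j + i) (leq_addr _ _).
  have := @cv_st (t * j + i) _ (leqnSn _).
  rewrite addnS mulSn; move: IH; set a := left_over j.
  move: (cv _) (cv _) (cv _) => x y z; nia.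
have := gain_i t (leqnn t); rewrite leq_pmul2l // -mulnSr.
by have := @cv_st (t * j) (t * j.+1); rewrite leq_pmul2l // leqnSn => /(_ isT); lia.
Qed.

(** The algorithm can lag behind [top j] only by items left over, so [left_over j] is at least
    [sigma j.+1 - u j]; insert this into [level_gain]. *)
Lemma sigmaS j : (forall r, t * j <= r < t * j.+1 -> ~~ event r) ->
  4 * sigma j.+1 <= 3 * u j + sigma j.
Proof.
move=> /level_gain; rewrite /sigma /u /left_over cardsD.
have : #|seq_cov (top j) :&: seq_cov (st (t * j.+1))| <= cv (st (t * j.+1)).
  by rewrite subset_leq_card // subsetIr.
have : cv (top j) <= F by rewrite subset_leq_card // seq_cov_sub // => i; apply: mem_take.
lia.
Qed.

(** The extra term makes the induction telescope: passing to J+1 adds 2^J (4 sigma(J+1) - sigma J),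
    at most 3 2^J u J. The 8 is 2 for the initial deficit [F] plus 3 times the 2 of condensation. *)
Lemma potential_bound J : (forall r, r < t * J -> ~~ event r) ->
  \sum_(j < J.+1) 2 ^ j * sigma j + 2 ^ J * sigma J <= 8 * cover_time opt.
Proof.
move=> no_event.
suff : \sum_(j < J.+1) 2 ^ j * sigma j + 2 ^ J * sigma J <=
    2 * F + 3 * \sum_(j < J) 2 ^ j * u j.
  have : \sum_(j < J) 2 ^ j * u j <= 2 * cover_time opt := dyadic_cover_time opt J.
  by have : F <= cover_time opt := seq_cov_le_cover_time opt; lia.
elim: J no_event => [|J IH] no_event.
  by rewrite big_ord_recl !big_ord0 /= !mul1n /sigma; lia.
rewrite big_ord_recr [in leqRHS]big_ord_recr /= expnS; have := @sigmaS J.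
have /IH : forall r, r < t * J -> ~~ event r.
  by move=> r lt_r; apply: no_event; rewrite mulnSr ltn_addr.
move=> + /(_ _) leS; have {}leS : 4 * sigma J.+1 <= 3 * u J + sigma J.
  by apply: leS => r /andP[_]; apply: no_event.
move: (\sum_(_ < _) _) (\sum_(_ < _) _) (2 ^ J) => x y z; nia.
Qed.

(** Otherwise the deficit at level [M] is positive and the potential at least 2^M. The summands
    [items I] and [sets I] of [M] beat the trivial bound items times sets on a cover time, and the 3
    supplies the factor 8. *)
Lemma first_event : exists r,
  [/\ r < t * (items I + sets I + 3), event r & forall q, q < r -> ~~ event q].
Proof.
set M := items I + sets I + 3.
have [r lt_r ev] : exists2 r, r < t * M & event r.
  case: (boolP (has event (iota 0 (t * M)))) => [/hasP[r] | /hasPn none].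
    by rewrite mem_iota => lt_r ev; exists r.
  have {}none r : r < t * M -> ~~ event r by move=> lt_r; apply: none; rewrite mem_iota.
  have := potential_bound none.
  have : 0 < sigma M.
    have tM : t * M = (t * M).-1.+1 by rewrite prednK // muln_gt0 t_gt0 /M addn3.
    have := none (t * M).-1; rewrite tM ltnSn => /(_ isT).
    rewrite /event -tM negb_or -ltnNge /sigma subn_gt0 => /andP[lt_N _].
    exact: leq_trans lt_N opt_covers.
  have := cover_time_le opt; have := prec_closed_seq_size opt_closed.
  rewrite /M !expnD; have := ltn_expl (items I) (isT : 1 < 2).
  have := ltn_expl (sets I) (isT : 1 < 2).
  move: (2 ^ items I) (2 ^ sets I) (\sum_(_ < _) _) => x y z lt_y lt_x le_s le_c sig.
  have : cover_time opt < x * y.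
    by apply: (leq_ltn_trans le_c); nia.
  nia.
case: (ex_minnP (ex_intro _ r ev)) => q ev_q min_q; exists q; split=> //.
  exact: leq_ltn_trans (min_q r ev) lt_r.
by move=> k lt_k; apply/negP => /min_q; rewrite leqNgt lt_k.
Qed.

(** Each of the [t] rounds of a level is charged the value of [h] at the start of the level. *)
Lemma sum_levels (h : nat -> nat) K : (forall q r, q <= r -> h r <= h q) ->
  \sum_(q < t * K) 2 ^ (q %/ t) * h q <= t * \sum_(j < K) 2 ^ j * h (t * j).
Proof.
move=> h_anti; elim: K => [|K IH]; first by rewrite muln0 !big_ord0.
rewrite mulnSr big_split_ord big_ord_recr mulnDr leq_add //=.
rewrite (@leq_trans (\sum_(i < t) 2 ^ K * h (t * K))) //; last first.
  by rewrite sum_nat_const card_ord.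
by apply: leq_sum => i _; rewrite level_round // leq_mul // h_anti ?leq_addr.
Qed.

Lemma sum_exp2 J : \sum_(j < J.+1) 2 ^ j * 1 <= 2 * 2 ^ J.
Proof.
suff : (\sum_(j < J.+1) 2 ^ j * 1).+1 <= 2 ^ J.+1 by rewrite expnS; lia.
elim: J => [|J IH]; first by rewrite big_ord_recl big_ord0.
by rewrite big_ord_recr /= [leqRHS]expnS; move: IH; move: (\sum_(_ < _) _) (2 ^ _) => x y; lia.
Qed.

Lemma sum_uncovered_cat (a b : seq 'I_(sets I)) :
  \sum_(k < size (a ++ b)) (F - cv (take k (a ++ b))) <=
  \sum_(k < size a) (F - cv (take k a)) + size b * (F - cv a).
Proof.
rewrite size_cat big_split_ord leq_add //=.
  by apply: leq_sum => k _; rewrite take_cat ltn_ord.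
apply: (@leq_trans (\sum_(k < size b) (F - cv a))); last by rewrite sum_nat_const card_ord.
apply: leq_sum => k _; rewrite leq_sub2l // subset_leq_card // seq_cov_sub // => i a_i.
by rewrite take_cat ltnNge leq_addr /= mem_cat a_i.
Qed.

Lemma sum_uncovered_st r :
  \sum_(k < size (st r)) (F - cv (take k (st r))) <=
  \sum_(q < r) A * (2 ^ (q %/ t) * (F - cv (st q))).
Proof.
elim: r => [|r IH]; first by rewrite st0 !big_ord0.
rewrite big_ord_recr /= stS; apply: leq_trans (sum_uncovered_cat _ _) _.
by rewrite leq_add // mulnA leq_mul.
Qed.

Lemma size_st r : size (st r) <= \sum_(q < r) A * (2 ^ (q %/ t) * 1).
Proof.
elim: r => [|r IH]; first by rewrite st0 big_ord0.
by rewrite big_ord_recr /= stS size_cat leq_add // muln1.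
Qed.

Lemma sum_rounds r (h : nat -> nat) : (forall q s, q <= s -> h s <= h q) ->
  \sum_(q < r.+1) A * (2 ^ (q %/ t) * h q) <=
  A * (t * \sum_(j < (r %/ t).+1) 2 ^ j * h (t * j)).
Proof.
move=> h_anti; rewrite -big_distrr leq_mul2l; apply/orP; right => /=.
apply: leq_trans (sum_levels _ h_anti).
have lt_r : r < t * (r %/ t).+1 by rewrite mulnC ltn_ceil.
rewrite -!(big_mkord xpredT (fun q => 2 ^ (q %/ t) * h q)).
by rewrite [leqRHS](big_cat_nat _ lt_r) //= leq_addr.
Qed.

(** With at most N + v items in the final cover, a step misses at most v more than its deficit to
    [F]. The v is paid once per position, of which there are at most 2 A t 2^J; the deficits are
    summed level by level. *)
Lemma cover_time_round r e k v :
    size e <= A * 2 ^ (r %/ t) -> cv (take k (st r ++ e)) <= N + v ->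
  cover_time (take k (st r ++ e)) <=
  v * (A * (t * (2 * 2 ^ (r %/ t)))) +
  A * (t * \sum_(j < (r %/ t).+1) 2 ^ j * sigma j).
Proof.
move=> size_e; set S := st r ++ e; set c := take k S => le_c.
have size_S : size S <= A * (t * (2 * 2 ^ (r %/ t))).
  apply: (@leq_trans (\sum_(q < r.+1) A * (2 ^ (q %/ t) * 1))).
    by rewrite big_ord_recr /= size_cat leq_add ?size_st // muln1.
  apply: leq_trans (sum_rounds r (h := fun=> 1) _) _ => //.
  by rewrite !leq_mul // sum_exp2.
have le_size : size c <= size S by rewrite size_take_min geq_minr.
have uncov : \sum_(l < size S) (F - cv (take l S)) <=
    A * (t * \sum_(j < (r %/ t).+1) 2 ^ j * sigma j).
  apply: leq_trans (sum_uncovered_cat _ _) _.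
  apply: leq_trans (sum_rounds r (h := fun q => F - cv (st q)) _); last first.
    by move=> q s le_qs; rewrite leq_sub2l // cv_st.
  by rewrite big_ord_recr /= leq_add ?sum_uncovered_st // mulnA leq_mul.
rewrite cover_timeE.
apply: (@leq_trans (\sum_(l < size c) (v + (F - cv (take l S))))).
  apply: leq_sum => l _; have le_lk : l <= k.
    by apply: ltnW (leq_trans (ltn_ord l) _); rewrite size_take_min geq_minl.
  rewrite [take l c]take_takel //; have : N <= F := opt_covers; lia.
rewrite big_split sum_nat_const card_ord /= leq_add //.
  by rewrite mulnC leq_mul // (leq_trans le_size).
apply: leq_trans uncov.
rewrite -!(big_mkord xpredT (fun l => F - cv (take l S))).
by rewrite [leqRHS](big_cat_nat _ le_size) //= leq_addr.
Qed.

(** The set that crosses the target lies in [e], since [st r] is below it. Fewer than N items are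
    covered before, and this set contributes only items new to [st r]. *)
Lemma overshoot r e k :
    cv (st r) < N -> N <= cv (take k (st r ++ e)) ->
    (forall l, l < k -> cv (take l (st r ++ e)) < N) ->
  exists2 i, i \in e & cv (take k (st r ++ e)) <= N + #|member i :\: seq_cov (st r)|.
Proof.
move=> st_lt; set S := st r ++ e => reach first_k.
case: k reach first_k => [|k] reach first_k.
  by move: reach; rewrite take0 /seq_cov leqNgt (leq_ltn_trans _ st_lt) // subset_leq_card ?seq_cov_sub.
have lt_k := first_k k (ltnSn k).
have lt_kS : k < size S.
  by rewrite ltnNge; apply/negP => le_S; move: reach lt_k; rewrite !take_oversize ?ltnNge ?leqW // => ->.
have le_st : size (st r) <= k.
  rewrite leqNgt; apply/negP => lt_kst; move: reach; rewrite leqNgt => /negP[].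
  apply: leq_ltn_trans st_lt; rewrite subset_leq_card // seq_cov_sub // => i.
  rewrite take_cat; case: ifP => _; first exact: mem_take.
  by rewrite (eqP (_ : k.+1 - size (st r) == 0)) ?subn_eq0 // take0 cats0.
have [i0 _] : exists i, i \in S by exists (tnth (in_tuple S) (Ordinal lt_kS)); apply: mem_tnth.
exists (nth i0 S k).
  by rewrite nth_cat ltnNge le_st mem_nth // ltn_subLR // -size_cat.
rewrite (take_nth i0) // -cats1 seq_cov_cat seq_cov_cons setUC.
have -> : seq_cov [::] = set0 :> {set 'I_(items I)}.
  by apply/setP=> x; rewrite in_seq_cov inE.
rewrite setU0; set m := member _.
have sub : seq_cov (st r) \subset seq_cov (take k S).
  apply: seq_cov_sub => i st_i; rewrite take_cat ltnNge le_st /= mem_cat st_i //.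
apply: (@leq_trans #|seq_cov (take k S) :|: (m :\: seq_cov (st r))|).
  rewrite subset_leq_card //; apply/subsetP=> x; rewrite !inE.
  have := subsetP sub x; case: (x \in seq_cov (st r)) => [->//|_].
  by rewrite orbC.
apply: leq_trans (leq_card_setU _ _).1 _.
by rewrite leq_add2r ltnW.
Qed.

Variable down : nat -> 'I_(sets I) -> seq 'I_(sets I).
Hypotheses (down_uniq : forall r i, uniq (down r i))
  (down_prec : forall r i j, j \in down r i -> prec j i)
  (down_self : forall r i, i \in st r ++ down r i).

(** The predecessors of a set in a prefix of a closed sequence lie in the same prefix. *)
Lemma size_down r i j : i \in top j -> size (down r i) <= 2 ^ j.
Proof.
move=> top_i; apply: (@leq_trans (size (top j))); last by rewrite size_take_min geq_minl.
apply: uniq_leq_size => // k /down_prec ki.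
have /forall_inP/(_ i) := prec_closed_take (2 ^ j) opt_closed; rewrite inE => /(_ top_i).
by move/forallP/(_ k); rewrite ki inE.
Qed.

Lemma good_candidate : exists r c,
  [/\ r < t * (items I + sets I + 3), c = st r.+1 \/ (exists i, c = st r ++ down r i),
      N <= cv c
    & forall k, N <= cv (take k c) -> (forall l, l < k -> cv (take l c) < N) ->
        cover_time (take k c) <= 32 * (A * t) * cover_time opt].
Proof.
have [r [lt_r ev first_r]] := first_event; set J := r %/ t.
have before j : j <= J -> forall q, q < t * j -> ~~ event q.
  by move=> le_j q lt_q; apply: first_r; apply: leq_trans lt_q _; rewrite mulnC -leq_divRL.
have potJ := potential_bound (before J (leqnn J)).
have st_lt : cv (st r) < N.
  case: (r) first_r => [|q] first_q.
    by rewrite st0 -[cv _](_ : 0 = _) // -(@cards0 'I_(items I)); apply: eq_card => x;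
      rewrite in_seq_cov inE.
  by have := first_q q (ltnSn q); rewrite /event negb_or -ltnNge => /andP[].
(* The overshoot costs twice 12 and the weighted deficits cost 8, together 32. The 12 is chosen
   large enough for both kinds of event. *)
have finish e k v : size e <= A * 2 ^ J -> cv (take k (st r ++ e)) <= N + v ->
    2 ^ J * v <= 12 * cover_time opt ->
    cover_time (take k (st r ++ e)) <= 32 * (A * t) * cover_time opt.
  move=> size_e le_c le_v; apply: leq_trans (cover_time_round size_e le_c) _; rewrite -/J.
  move: potJ le_v; move: (\sum_(_ < _) _) (2 ^ J) (cover_time opt) (sigma J) => x y z w lex lev.
  have -> : v * (A * (t * (2 * y))) = 2 * (A * t) * (y * v) by lia.
  have -> : A * (t * x) = A * t * x by lia.
  have lex' : x <= 8 * z by lia.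
  have := leq_mul (leqnn (2 * (A * t))) lev; have := leq_mul (leqnn (A * t)) lex'; lia.
have [reach|no_reach] := leqP N (cv (st r.+1)).
  exists r, (st r.+1); split=> //; first by left.
  move=> k; rewrite stS => reach_k min_k.
  have [i d_i le_i] := overshoot st_lt reach_k min_k.
  apply: (finish _ k _ (size_d r) le_i).
  (* A nonfinisher adds fewer items than the state lacks, and the deficit has only shrunk since the
     level began. *)
  have le_sigma : #|member i :\: seq_cov (st r)| <= sigma J.
    have := d_nonfinisher d_i; rewrite seq_cov_cons cardsU cardsD /sigma.
    have : #|member i :&: seq_cov (st r)| <= #|member i|.
      by rewrite subset_leq_card // subsetIl.
    have : cv (st (t * J)) <= cv (st r) by rewrite cv_st // mulnC leq_trunc_div.
    have : N <= F := opt_covers; lia.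
  have := leq_mul (leqnn (2 ^ J)) le_sigma; lia.
have [i0 top_i0 fin_i0] : exists2 i, i \in top J & N <= cv (i :: st r).
  by move: ev; rewrite /event leqNgt no_reach /= => /hasP[i top_i fin_i]; exists i.
exists r, (st r ++ down r i0); split=> //; first by right; exists i0.
  apply: leq_trans fin_i0 _; rewrite subset_leq_card // seq_cov_sub // => i.
  by rewrite inE => /predU1P[->|st_i]; rewrite ?down_self // mem_cat st_i.
move=> k reach_k min_k; have [i down_i le_i] := overshoot st_lt reach_k min_k.
apply: (finish _ k _ _ le_i); first by rewrite (leq_trans (size_down _ top_i0)) // leq_pmull.
have top_i : i \in top J.
  have /forall_inP/(_ i0) := prec_closed_take (2 ^ J) opt_closed; rewrite inE => /(_ top_i0).
  by move/forallP/(_ i); rewrite (down_prec down_i) inE.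
have sub_i : member i \subset seq_cov opt.
  apply/subsetP=> x i_x; rewrite in_seq_cov; apply/hasP; exists i => //.
  exact: mem_take top_i.
have le_F : F <= cover_time opt := seq_cov_le_cover_time opt.
(* Level 0 has no preceding level, but there the weight is 1 and the new items number at most
   [F]. *)
have [J0|[j JE]] : J = 0 \/ exists j, J = j.+1 by case: (J) => [|j]; [left|right; exists j].
  rewrite J0 mul1n; apply: (@leq_trans F); last lia.
  by rewrite subset_leq_card // (subset_trans _ sub_i) // subsetDl.
(* New items outside [top j] are among those the optimum covers after time 2^j; the others were on
   offer throughout level [j] and left over. Weighted by 2^j, the two parts are at most 2 and 8/3
   optimal cover times. *)
have le_v : #|member i :\: seq_cov (st r)| <= u j + left_over j.
  have top_sub : seq_cov (top j) \subset seq_cov opt.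
    by apply: seq_cov_sub => h; apply: mem_take.
  rewrite /u -cardsDS //; apply: leq_trans (leq_card_setU _ _).1.
  rewrite subset_leq_card //; apply/subsetP=> x; rewrite !inE => /andP[not_st i_x].
  rewrite (subsetP sub_i) // andbT; case: (x \in seq_cov (top j)) => //=.
  rewrite andbT; apply/negP => st_x; case/negP: not_st.
  by apply: subsetP st_x; rewrite cov_st // mulnC -JE leq_trunc_div.
have le_left : 3 * left_over j <= sigma j.
  have := level_gain (j := j); rewrite /sigma.
  have : cv (st (t * j.+1)) <= cv (st r) by rewrite cv_st // mulnC -JE leq_trunc_div.
  have : N <= F := opt_covers.
  move=> + + /(_ _) gain_j.
  have {}gain_j : 3 * left_over j + cv (st (t * j)) <= cv (st (t * j.+1)).
    by apply: gain_j => q /andP[_]; apply: before; rewrite JE.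
  lia.
have le_u : 2 ^ j * u j <= 2 * cover_time opt.
  apply: leq_trans (dyadic_cover_time opt j.+1).
  by rewrite big_ord_recr leq_addl.
have le_sigma : 2 ^ j * sigma j <= 8 * cover_time opt.
  by apply: leq_trans (potential_bound (before j _)); rewrite ?leq_addl // JE.
rewrite JE expnS; move: le_v le_left le_u le_sigma.
move: (2 ^ j) (u j) (left_over j) (sigma j) (cover_time opt) => a b c d' e le_v le1 le2 le3.
have := leq_mul (leqnn a) le_v; have := leq_mul (leqnn a) le1; lia.
Qed.

End Greedy.

(** * Correctness of the algorithm *)

(** The pairwise form of the ordering condition passes to subsequences and splits over
    concatenations. *)
Lemma prec_closed_seqE (I : instance) (s : seq 'I_(sets I)) :
  prec_closed_seq s =
  [&& uniq s, prec_closed [set i in s] & pairwise (fun i j => ~~ prec j i) s].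
Proof.
rewrite /prec_closed_seq; case uniq_s: (uniq s) => //=; congr andb.
apply/forall_inP/idP => [ordered | ordered i s_i].
  case: s => [|i0 s'] // in uniq_s ordered *; set s := i0 :: s' in uniq_s ordered *.
  apply/(pairwiseP i0) => a b lt_a lt_b lt_ab; apply/negP => ba.
  have := ordered _ (mem_nth i0 lt_b) => /forall_inP/(_ _ (mem_nth i0 lt_a)).
  by rewrite ba nth_uniq // !index_uniq // andbT gtn_eqF //= ltnNge (ltnW lt_ab).
apply/forall_inP=> j s_j; apply/implyP=> /andP[ne_ij ij]; rewrite ltnNge; apply/negP => le_ji.
have lt_ji : index j s < index i s.
  by rewrite ltn_neqAle le_ji andbT; apply: contra ne_ij => /eqP/(congr1 (nth i s)); rewrite !nth_index // => ->.
move/(pairwiseP i): ordered => /(_ (index j s) (index i s)).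
by rewrite !inE !index_mem s_i s_j => /(_ isT isT lt_ji); rewrite !nth_index // ij.
Qed.

Lemma prec_closed_seq_take (I : instance) (s : seq 'I_(sets I)) k :
  prec_closed_seq s -> prec_closed_seq (take k s).
Proof.
move=> closed_s; move: (closed_s); rewrite !prec_closed_seqE prec_closed_take //.
by case/and3P=> uniq_s _ pw; rewrite take_uniq // (subseq_pairwise (take_subseq _ _) pw).
Qed.

(** No set of [s] has a predecessor among the appended ones, as [s] is closed; the appended ones
    inherit the order of [L]. This serves both greedy rounds and the addition of predecessors. *)
Lemma prec_closed_seq_append (I : instance) (s L : seq 'I_(sets I)) (P : pred 'I_(sets I)) :
    prec_closed_seq s -> uniq L -> pairwise (fun i j => ~~ prec j i) L ->
    (forall i, i \in L) -> (forall i j, P i -> prec j i -> (P j) || (j \in s)) ->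
  prec_closed_seq (s ++ [seq i <- L | P i && ~~ (i \in s)]).
Proof.
rewrite !prec_closed_seqE => /and3P[uniq_s /forall_inP closed_s pw_s] uniq_L pw_L L_all P_closed.
have down_s i j : i \in s -> prec j i -> j \in s.
  by move=> s_i ji; have := closed_s i; rewrite inE => /(_ s_i)/forallP/(_ j); rewrite ji inE.
apply/and3P; split.
- rewrite cat_uniq uniq_s filter_uniq // andbT /=; apply/hasPn => i.
  by rewrite mem_filter => /andP[/andP[]].
- apply/forall_inP => i; rewrite inE mem_cat mem_filter L_all andbT => in_i.
  apply/forallP => j; apply/implyP => ji; rewrite inE mem_cat mem_filter L_all andbT.
  case: (boolP (j \in s)) => //= not_s; rewrite andbT; case/orP: in_i => [s_i|/andP[Pi _]].
    by rewrite (down_s i j) in not_s.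
  by have := P_closed i j Pi ji; rewrite (negPf not_s) orbF.
- rewrite pairwise_cat pw_s (subseq_pairwise (filter_subseq _ _) pw_L) !andbT.
  apply/allrelP => i j s_i; rewrite mem_filter => /andP[/andP[_ not_s] _].
  by apply: contra not_s; apply: down_s.
Qed.

(** * A linear extension of the partial order *)

Section KeySort.
Variables (key : nat -> nat) (s : seq nat).
Let by_key cs := flatten [seq [seq i <- s | key i == c] | c <- cs].

Lemma mem_by_key cs i : (i \in by_key cs) = (i \in s) && (key i \in cs).
Proof.
apply/flatten_mapP/andP => [[c cs_c] | [s_i cs_i]].
  by rewrite mem_filter => /andP[/eqP-> ->].
by exists (key i); rewrite // mem_filter eqxx.
Qed.

Lemma pairwise_by_key cs : uniq s -> pairwise ltn cs ->
  pairwise (fun i j => (i != j) && (key i <= key j)) (by_key cs).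
Proof.
move=> uniq_s; elim: cs => //= c cs IH /andP[lt_c pw_cs].
rewrite /by_key /= pairwise_cat IH // andbT; apply/andP; split.
  apply/allrelP => i j; rewrite mem_filter mem_by_key => /andP[/eqP ki _] /andP[_ cs_j].
  have := allP lt_c _ cs_j; rewrite ki /= => lt_kj; rewrite (ltnW lt_kj) andbT.
  by apply/eqP => ij; rewrite -ij ki ltnn in lt_kj.
apply: (sub_in_pairwise (P := fun i => key i == c) (r := fun i j => i != j)).
- by move=> i j /eqP ki /eqP kj ->; rewrite ki kj leqnn.
- exact: filter_all.
- by rewrite -uniq_pairwise filter_uniq.
Qed.

End KeySort.

Section LinearOrder.
Variable I : instance.

Definition sorted_sets : seq 'I_(sets I) := pmap insub (linear_order I).

Lemma linear_orderE : linear_order I = map val sorted_sets.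
Proof.
rewrite /sorted_sets (pmap_filter (@insubK _ _ _)).
rewrite (eq_in_filter (a2 := xpredT)) ?filter_predT // => i.
by rewrite mem_by_key mem_iota add0n => /andP[/andP[_ lt_i] _]; rewrite insubT.
Qed.

Lemma down_sizeE (i : 'I_(sets I)) : down_size I i = #|[set j | prec j i]|.
Proof.
rewrite /down_size -val_enum_ord filter_map size_map -sum1_size big_filter.
rewrite -sum1_card big_enum_cond; apply: eq_bigl => j.
by rewrite !inE /= precedesE.
Qed.

Lemma mem_sorted_sets i : i \in sorted_sets.
Proof.
rewrite -(mem_map val_inj) -linear_orderE mem_by_key !mem_iota /= !add0n ltn_ord /=.
by rewrite ltnS down_sizeE -[leqRHS]card_ord max_card.
Qed.

(** A strict predecessor j of i has strictly fewer predecessors: transitivity gives the inclusion,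
    and i itself is missing by antisymmetry. *)
Lemma pairwise_sorted_sets :
  pairwise (fun i j => (i != j) && ~~ prec j i) sorted_sets.
Proof.
have := @pairwise_by_key (down_size I) _ (iota 0 (sets I).+1) (iota_uniq 0 (sets I)).
have -> : pairwise ltn (iota 0 (sets I).+1) by rewrite -sorted_pairwise ?iota_ltn_sorted //; apply: ltn_trans.
rewrite -/(linear_order I) linear_orderE pairwise_map => /(_ isT).
apply: sub_pairwise => i j /= /andP[ne_ij]; rewrite (inj_eq val_inj) in ne_ij.
rewrite ne_ij !down_sizeE /=; apply: contraL => ji; rewrite -ltnNge; apply: proper_card.
apply/properP; split.
  by apply/subsetP => k; rewrite !inE => /prec_trans; apply.
exists i; rewrite inE ?prec_refl //; apply: contra ne_ij => ij.
by apply/eqP/prec_anti; rewrite ij.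
Qed.

Lemma sorted_sets_uniq : uniq sorted_sets.
Proof.
rewrite uniq_pairwise; apply: sub_pairwise pairwise_sorted_sets => i j /=.
by case/andP.
Qed.

Lemma sorted_sets_ordered : pairwise (fun i j => ~~ prec j i) sorted_sets.
Proof. by apply: sub_pairwise pairwise_sorted_sets => i j /= /andP[]. Qed.

End LinearOrder.

Lemma has_ord (m : nat) (a : pred nat) : has a (iota 0 m) = [exists i : 'I_m, a i].
Proof.
rewrite -val_enum_ord has_map; apply/hasP/existsP => [[i _ ai] | [i ai]]; first by exists i.
by exists i; rewrite ?mem_enum.
Qed.

(** * Agreement of numeric and typed notions *)

Section NatTyped.
Variable I : instance.
Implicit Types (s : seq 'I_(sets I)) (x : 'I_(items I)).

Lemma coversE s x : covers I (map val s) x = (x \in seq_cov s).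
Proof.
by rewrite /covers has_map in_seq_cov; apply: eq_has => i; rewrite /= incidentE.
Qed.

Lemma filter_items (a : pred nat) (b : pred 'I_(items I)) : (forall x, a x = b x) ->
  [seq x <- iota 0 (items I) | a x] = map val [seq x <- enum 'I_(items I) | b x].
Proof. by move=> ab; rewrite -val_enum_ord filter_map; congr map; apply: eq_filter. Qed.

Lemma coverageE s : coverage I (map val s) = #|seq_cov s|.
Proof.
rewrite /coverage (filter_items (b := fun x => x \in seq_cov s)) ?size_map; last exact: coversE.
by rewrite -sum1_size big_filter -sum1_card big_enum_cond; apply: eq_bigl => x.
Qed.

Lemma costE s : cost I (map val s) = cover_time s.
Proof.
rewrite /cost (filter_items (b := fun x => x \in seq_cov s)); last exact: coversE.
rewrite size_flatten sumnE /shape !big_map big_filter big_enum_cond.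
rewrite /cover_time; apply: eq_big => // x /andP[_ s_x]; rewrite /coverage_time s_x.
rewrite -size_unhit_prefixes -?in_seq_cov // size_map; congr size; apply: eq_filter => k.
by rewrite -map_take coversE in_seq_cov.
Qed.

End NatTyped.

(** The ceiling of f n; adding the denominator minus one rounds the quotient up. *)
Definition target p : nat := (items p.1 * `|numq p.2| + (`|denq p.2|).-1) %/ `|denq p.2|.

Lemma denq_abs_gt0 (f : rat) : 0 < `|denq f|.
Proof. by rewrite absz_gt0 denq_neq0. Qed.

Lemma target_leq p c : (target p <= c) = (items p.1 * `|numq p.2| <= c * `|denq p.2|).
Proof.
rewrite -ltnS /target ltn_divLR ?denq_abs_gt0 //; have := denq_abs_gt0 p.2.
by rewrite mulSn; lia.
Qed.

Lemma on_targetE p (s : seq 'I_(sets p.1)) :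
  on_target p (map val s) = (target p <= #|seq_cov s|).
Proof. by rewrite /on_target leqbitsE !bitval_mulbits !natbitsK coverageE target_leq. Qed.

Lemma finisherE p (s : seq 'I_(sets p.1)) (i : 'I_(sets p.1)) :
  finisher p (map val s) i = (target p <= #|seq_cov (i :: s)|).
Proof. exact: (on_targetE (i :: s)). Qed.

Lemma blockedP p (s : seq 'I_(sets p.1)) (i : 'I_(sets p.1)) :
  reflect (exists2 j, target p <= #|seq_cov (j :: s)| & prec j i) (blocked p (map val s) i).
Proof.
rewrite /blocked has_ord; apply: (iffP existsP) => -[j].
  by rewrite finisherE precedesE => /andP[fin_j ji]; exists j.
by move=> fin_j ji; exists j; rewrite finisherE precedesE fin_j.
Qed.

(** The relabelling of residual items is injective, and an uncovered item in an unblocked set always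
    has a label. *)
Lemma card_residual_cov p (s : seq 'I_(sets p.1)) (O : {set 'I_(sets p.1)}) :
  #|@cov (residual p (map val s)) O| =
  #|[set x | (x \notin seq_cov s) &&
     [exists i in O, ~~ blocked p (map val s) i && (x \in member i)]]|.
Proof.
set r := map val s; pose f := tnth (in_tuple (residual_items p r)).
have f_inj : injective f.
  by apply/tuple_uniqP; rewrite filter_uniq // enum_uniq.
rewrite -(card_imset _ f_inj); apply: eq_card => x; rewrite !inE.
apply/imsetP/andP => [[y /bigcupP[i O_i]] | [not_s /existsP[i /and3P[O_i unblocked i_x]]]].
  rewrite inE => /andP[unblocked i_y] ->; split.
    have := mem_tnth y (in_tuple (residual_items p r)).
    by rewrite mem_filter /residual_item coversE => /andP[/andP[]].
  by apply/existsP; exists i; rewrite O_i unblocked.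
have /tnthP[y xE] : x \in in_tuple (residual_items p r).
  rewrite mem_filter mem_enum andbT /residual_item coversE not_s has_ord.
  by apply/existsP; exists i; rewrite unblocked incidentE.
by exists y => //; apply/bigcupP; exists i => //; rewrite inE unblocked -xE.
Qed.

Lemma antitone_iota (P : pred nat) n : (forall k l, k <= l -> P l -> P k) ->
  let k := size [seq k <- iota 0 n | P k] in
  (forall l, l < k -> P l) /\ (k < n -> ~~ P k).
Proof.
move=> anti; elim: n => [|n [IH1 IH2]]; first by [].
have -> : size [seq k <- iota 0 n.+1 | P k] = size [seq k <- iota 0 n | P k] + P n.
  by rewrite -addn1 iotaD filter_cat size_cat /= add0n; case: (P n).
set k := size _ in IH1 IH2 *; have le_kn : k <= n.
  by rewrite /k size_filter -[leqRHS](size_iota 0) count_size.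
case Pn : (P n) => /=; last first.
  rewrite addn0; split=> // _; move: le_kn; rewrite leq_eqVlt => /predU1P[->|/IH2 //].
  by rewrite Pn.
have kn : k = n.
  apply/eqP; rewrite eqn_leq le_kn leqNgt; apply/negP => lt_kn.
  by have := IH2 lt_kn; rewrite (anti _ _ (ltnW lt_kn) Pn).
rewrite kn addn1; split; last by rewrite ltnn.
by move=> l; rewrite ltnS => le_ln; apply: anti Pn.
Qed.

Lemma truncateE p (s : seq 'I_(sets p.1)) : exists k,
  [/\ truncate p (map val s) = map val (take k s),
      forall l, l < k -> #|seq_cov (take l s)| < target p
    & target p <= #|seq_cov s| -> target p <= #|seq_cov (take k s)|].
Proof.
pose P k := ~~ (target p <= #|seq_cov (take k s)|).
have P_anti k l : k <= l -> P l -> P k.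
  move=> le_kl; apply: contra => /leq_trans; apply.
  by rewrite subset_leq_card // seq_cov_take.
have [below above] := antitone_iota (size s) P_anti.
exists (size [seq k <- iota 0 (size s) | P k]); split.
- rewrite /truncate size_map map_take; congr take; congr size; apply: eq_filter => k.
  by rewrite -map_take on_targetE.
- by move=> l /below; rewrite /P -ltnNge.
- move=> reach; move: above; set k := size _; case: (ltnP k (size s)) => [_ /(_ isT)|le _].
    by rewrite negbK.
  by rewrite take_oversize.
Qed.

(** * Correctness of the selected candidate *)

Section Correctness.
Variables (oracle : instance * nat -> seq bool) (t A : nat).
Hypotheses (t_gt0 : 0 < t) (A_gt0 : 0 < A).
Hypothesis oracleP : forall I k, 0 < k -> exists C : {set 'I_(sets I)},
  [/\ oracle (I, k) = [seq i \in C | i <- enum 'I_(sets I)], prec_closed C,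
      3 * bpcsc_opt I k <= t * #|cov C| & #|C| <= A * k].

Section Run.
Variable p : instance * rat.
Local Notation I := p.1.
Local Notation N := (target p).
Local Notation cv s := #|seq_cov s|.

Fixpoint nth_state r : seq nat :=
  if r is r'.+1 then greedy_round oracle p (nth_state r') (r' %/ t) else [::].

Lemma levelsE : levels t I = [seq r %/ t | r <- iota 0 (t * (items I + sets I + 4))].
Proof.
rewrite /levels; elim: (_ + 4) => [|K IH]; first by rewrite muln0.
rewrite -addn1 iotaD map_cat flatten_cat IH mulnDr muln1 iotaD map_cat /= cats0 !add0n.
congr cat; apply: (@eq_from_nth _ 0) => [|i]; rewrite size_nseq ?size_map ?size_iota // => lt_i.
by rewrite nth_nseq lt_i (nth_map 0) ?size_iota // nth_iota // level_round.
Qed.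

Lemma mem_states s : s \in states oracle t p <->
  exists2 r, r <= t * (items I + sets I + 4) & s = nth_state r.
Proof.
rewrite /states levelsE; set K := t * _.
have -> : foldl (fun h j => greedy_round oracle p (head [::] h) j :: h) [:: [::]]
    [seq r %/ t | r <- iota 0 K] = [seq nth_state r | r <- rev (iota 0 K.+1)].
  have iotaS k : iota 0 k.+1 = rcons (iota 0 k) k by rewrite -addn1 iotaD cats1.
  by elim: K => // K IH; rewrite [in LHS]iotaS map_rcons foldl_rcons IH !iotaS !rev_rcons.
split=> [/mapP[r] | [r le_r ->]].
  by rewrite mem_rev mem_iota ltnS => le_r ->; exists r.
by rewrite map_f // mem_rev mem_iota ltnS.
Qed.

Definition added r : seq 'I_(sets I) :=
  [seq i : 'I_(sets I) <- sorted_sets I |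
    (nth false (oracle (residual p (nth_state r), 2 ^ (r %/ t))) i &&
     ~~ blocked p (nth_state r) i) && ~~ (val i \in nth_state r)].

Fixpoint typed_state r : seq 'I_(sets I) :=
  if r is r'.+1 then typed_state r' ++ added r' else [::].

Lemma nth_stateE r : nth_state r = map val (typed_state r).
Proof.
elim: r => //= r IH; rewrite map_cat -IH /greedy_round linear_orderE filter_map.
by congr (_ ++ map _ _); apply: eq_filter => i; rewrite /= andbA.
Qed.

Lemma addedP r : exists C : {set 'I_(sets I)},
  [/\ prec_closed C, #|C| <= A * 2 ^ (r %/ t),
      added r = [seq i : 'I_(sets I) <- sorted_sets I |
        (i \in C) && ~~ blocked p (nth_state r) i && ~~ (i \in typed_state r)]
    & 3 * bpcsc_opt (residual p (nth_state r)) (2 ^ (r %/ t)) <=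
      t * #|@cov (residual p (nth_state r)) C|].
Proof.
have [|C [CE closed_C ratio_C size_C]] := @oracleP (residual p (nth_state r)) (2 ^ (r %/ t)).
  by rewrite expn_gt0.
exists C; split=> //; apply: eq_filter => i; rewrite CE.
rewrite (nth_map i) ?size_enum_ord // nth_ord_enum.
by congr (_ && ~~ _); rewrite nth_stateE mem_map //; apply: val_inj.
Qed.

(** Successors of blocked sets are blocked, so removing blocked sets from the closed family of the
    oracle keeps it closed. *)
Lemma typed_state_closed r : prec_closed_seq (typed_state r).
Proof.
elim: r => [|r IH].
  by rewrite prec_closed_seqE /= andbT; apply/forall_inP => i; rewrite inE.
have [C [/forall_inP closed_C _ addE _]] := addedP r; rewrite /= addE.
apply: prec_closed_seq_append IH (sorted_sets_uniq I) (sorted_sets_ordered I)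
  (@mem_sorted_sets I) _ => i j /andP[C_i unblocked] ji.
have /forallP/(_ j) := closed_C i C_i; rewrite ji /= => ->.
rewrite (contra _ unblocked) // nth_stateE => /blockedP[k fin_k kj].
by apply/blockedP; exists k => //; apply: prec_trans ji.
Qed.

Lemma size_added r : size (added r) <= A * 2 ^ (r %/ t).
Proof.
have [C [_ size_C -> _]] := addedP r; apply: leq_trans size_C.
rewrite cardE; apply: uniq_leq_size; first by rewrite filter_uniq ?sorted_sets_uniq.
by move=> i; rewrite mem_filter mem_enum => /andP[/andP[/andP[]]].
Qed.

Lemma added_nonfinisher r i : i \in added r -> cv (i :: typed_state r) < N.
Proof.
have [C [_ _ -> _]] := addedP r; rewrite mem_filter => /andP[/andP[/andP[_ unblocked] _] _].
rewrite ltnNge; apply: contra unblocked => fin_i; rewrite nth_stateE.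
by apply/blockedP; exists i; rewrite ?prec_refl.
Qed.

(** A blocked member of [O] would have a finisher as predecessor, again in [O] by closedness. So [O]
    is fully visible in the residual instance, and what the oracle covers there is newly covered by
    the round. *)
Lemma added_gain r (O : {set 'I_(sets I)}) :
    prec_closed O -> #|O| <= 2 ^ (r %/ t) ->
    (forall i, i \in O -> cv (i :: typed_state r) < N) ->
  3 * #|cov O :\: seq_cov (typed_state r)| <=
  t * (cv (typed_state r.+1) - cv (typed_state r)).
Proof.
move=> closed_O size_O nofin; have [C [_ _ addE]] := addedP r.
set s := typed_state r in nofin addE *; rewrite nth_stateE -/s in addE * => gainC.
have unblocked i : i \in O -> ~~ blocked p (map val s) i.
  move=> O_i; apply/blockedP => -[j fin_j ji].
  have /forall_inP/(_ i O_i)/forallP/(_ j) := closed_O; rewrite ji /= => /nofin.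
  by rewrite ltnNge fin_j.
have leO : #|cov O :\: seq_cov s| <= bpcsc_opt (residual p (map val s)) (2 ^ (r %/ t)).
  apply: (@leq_trans #|@cov (residual p (map val s)) O|).
    rewrite card_residual_cov subset_leq_card //; apply/subsetP => x; rewrite !inE.
    case/andP=> -> /bigcupP[i O_i i_x]; apply/existsP; exists i.
    by rewrite O_i unblocked.
  rewrite /bpcsc_opt; apply: (bigmax_sup (O : {set 'I_(sets (residual p (map val s)))})) => //.
  by rewrite size_O andbT.
apply: leq_trans (leq_mul (leqnn 3) leO) (leq_trans gainC _).
rewrite leq_mul2l card_residual_cov -cardsDS ?[X in _ || X]subset_leq_card ?orbT //.
  apply/subsetP => x; rewrite !inE => /andP[not_s /existsP[i /and3P[C_i unb i_x]]].
  rewrite not_s /= -/s seq_cov_cat inE (negPf not_s) in_seq_cov; apply/hasP; exists i => //.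
  rewrite addE mem_filter mem_sorted_sets C_i unb andbT /=.
  by apply: contra not_s => s_i; rewrite in_seq_cov; apply/hasP; exists i.
by rewrite /= seq_cov_cat subsetUl.
Qed.

Definition down_added r i : seq 'I_(sets I) :=
  [seq j : 'I_(sets I) <- sorted_sets I | prec j i && ~~ (j \in typed_state r)].

Lemma add_downE r (i : 'I_(sets I)) :
  add_down I (nth_state r) i = map val (typed_state r ++ down_added r i).
Proof.
rewrite nth_stateE map_cat /add_down linear_orderE filter_map; congr (_ ++ map _ _).
by apply: eq_filter => j; rewrite /= precedesE mem_map //; apply: val_inj.
Qed.

Lemma down_added_closed r i : prec_closed_seq (typed_state r ++ down_added r i).
Proof.
apply: prec_closed_seq_append (typed_state_closed r) (sorted_sets_uniq I)
  (sorted_sets_ordered I) (@mem_sorted_sets I) _ => j k ji kj.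
by rewrite (prec_trans kj ji).
Qed.

Lemma sorted_sets_closed : prec_closed_seq (sorted_sets I).
Proof.
rewrite prec_closed_seqE sorted_sets_uniq sorted_sets_ordered andbT.
apply/forall_inP => i _; apply/forallP => j; apply/implyP => _.
by rewrite inE mem_sorted_sets.
Qed.

Lemma sorted_sets_cov : seq_cov (sorted_sets I) = [set: 'I_(items I)].
Proof.
rewrite -(member_cover I); apply/setP => x; rewrite in_seq_cov.
by apply/hasP/bigcupP => -[i _ i_x]; exists i => //; apply: mem_sorted_sets.
Qed.

Lemma candidates_closed c : c \in candidates oracle t p ->
  exists2 s : seq 'I_(sets I), c = map val s & prec_closed_seq s.
Proof.
rewrite mem_cat => /orP[/mem_states[r _ ->] | /flatten_mapP[s /mem_states[r _ ->] /mapP[i]]].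
  by exists (typed_state r); rewrite ?nth_stateE ?typed_state_closed.
rewrite mem_iota add0n => /andP[_ lt_i] ->; exists (typed_state r ++ down_added r (Ordinal lt_i)).
  exact: (add_downE r (Ordinal lt_i)).
exact: down_added_closed.
Qed.

Lemma foldl_choose_better acc l : let b := foldl (choose_better p) acc l in
  [/\ b = acc \/ (exists2 c, c \in l & on_target p c /\ b = truncate p c),
      cost I b <= cost I acc
    & forall c, c \in l -> on_target p c -> cost I b <= cost I (truncate p c)].
Proof.
elim: l acc => [|c l IH] acc /=; first by split=> //; left.
have [origin le_b le_l] := IH (choose_better p acc c); set b := foldl _ _ l in origin le_b le_l *.
have le_acc : cost I (choose_better p acc c) <= cost I acc.
  by rewrite /choose_better; case: ifP => // /andP[].
split.
- case: origin => [-> | [c' l_c' c'P]].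
    rewrite /choose_better; case: ifP => [/andP[tc _] | _]; last by left.
    by right; exists c; rewrite ?mem_head.
  by right; exists c' => //; rewrite inE l_c' orbT.
- exact: leq_trans le_acc.
- move=> c'; rewrite inE => /predU1P[-> tc | ]; last exact: le_l.
  apply: leq_trans le_b _; rewrite /choose_better tc /=.
  by case: ifP => // /negbT; rewrite -ltnNge => /ltnW.
Qed.

Hypothesis target_le : N <= items I.
Hypothesis items_eq0 : N = 0 -> items I = 0.

Lemma best_candidateP : exists b : seq 'I_(sets I),
  [/\ best_candidate oracle t p = map val b, prec_closed_seq b, N <= cv b
    & forall s : seq 'I_(sets I), prec_closed_seq s -> N <= cv s ->
        cover_time b <= 32 * (A * t) * cover_time s].
Proof.
have [origin _ best] := foldl_choose_better (truncate p (linear_order I)) (candidates oracle t p).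
have [b [bE closed_b reach_b]] : exists b : seq 'I_(sets I),
    [/\ best_candidate oracle t p = map val b, prec_closed_seq b & N <= cv b].
  have trunc (s : seq 'I_(sets I)) : prec_closed_seq s -> N <= cv s -> exists b : seq 'I_(sets I),
      [/\ truncate p (map val s) = map val b, prec_closed_seq b & N <= cv b].
    move=> closed_s reach_s; have [k [sE _ /(_ reach_s) reach_k]] := truncateE s.
    by exists (take k s); split=> //; apply: prec_closed_seq_take.
  rewrite /best_candidate; case: origin => [-> | [c c_in [tc ->]]].
    rewrite linear_orderE; apply: trunc sorted_sets_closed _.
    by rewrite sorted_sets_cov cardsT card_ord.
  have [s cE closed_s] := candidates_closed c_in; rewrite cE in tc *.
  by apply: trunc => //; rewrite -on_targetE.
exists b; split=> // s closed_s reach_s.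
(* A zero target means an empty universe, where all cover times vanish; the greedy analysis assumes
   a positive target. *)
have [N0 | N_gt0] := posnP N.
  by have := cover_time_le b; rewrite items_eq0 // mul0n leqn0 => /eqP ->.
have down_self r i : i \in typed_state r ++ down_added r i.
  rewrite mem_cat mem_filter prec_refl mem_sorted_sets andbT.
  by case: (i \in typed_state r).
have down_prec r i j : j \in down_added r i -> prec j i.
  by rewrite mem_filter => /andP[/andP[]].
have down_uniq r i : uniq (down_added r i) by rewrite filter_uniq ?sorted_sets_uniq.
have [r [c [lt_r c_state reach_c cost_c]]] :=
  good_candidate N_gt0 A_gt0 t_gt0 (erefl : typed_state 0 = [::]) (fun=> erefl)
    size_added added_nonfinisher added_gain closed_s reach_s down_uniq down_prec down_self.
have le_r : r < t * (items I + sets I + 4).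
  by apply: leq_trans lt_r _; rewrite leq_mul2l leq_add2l orbT.
have c_in : map val c \in candidates oracle t p.
  rewrite mem_cat; apply/orP; case: c_state => [-> | [i ->]]; [left | right].
    by apply/mem_states; exists r.+1; rewrite ?nth_stateE.
  apply/flatten_mapP; exists (nth_state r); first by apply/mem_states; exists r; rewrite ?(ltnW le_r).
  by apply/mapP; exists (val i); rewrite ?add_downE // mem_iota add0n ltn_ord.
have := best _ c_in; rewrite on_targetE reach_c => /(_ isT).
rewrite -/(best_candidate oracle t p) bE.
have [k [-> below /(_ reach_c) reach_k]] := truncateE c.
by rewrite !costE => /leq_trans; apply; apply: cost_c.
Qed.

End Run.
End Correctness.

(** * From a BPCSC program to a PCMSSC program *)

Import Order.TTheory GRing.Theory Num.Theory.

Lemma encode_bits_inj : injective (encode : seq bool -> tree).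
Proof.
elim=> [|b s IH] [|c s'] // [bc ss']; congr cons; last exact: IH.
by case: b c bc => [] [].
Qed.

Lemma enc_bitvecE m (P : pred 'I_m) : enc_bitvec P = encode [seq P i | i <- enum 'I_m].
Proof. by rewrite /encode /encodable_seq enc_seq_map. Qed.

Lemma sets_le_enc_bpcsc z : sets z.1 <= tree_size (enc_bpcsc z).
Proof.
rewrite -size_rows; apply: (@leq_trans (esize (rows z.1))); first exact: ltnW (esize_size _).
have nodeE u v : tree_size (Node u v) = (tree_size u + tree_size v).+1 by [].
have -> : enc_bpcsc z = Node (encode z.1) (enc_nat z.2) by [].
by rewrite encode_instanceE !nodeE /esize; lia.
Qed.

(** The guarantee on [P] only asserts that a good run exists; choice fixes one answer per query and
    turns the program into a function. *)
Lemma bpcsc_oracle (R : realType) (alpha beta : R) P :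
  bpcsc_approx_algorithm alpha beta P -> exists oracle : instance * nat -> seq bool,
    (forall z, 0 < z.2 -> bpcsc_good alpha beta z (encode (oracle z))) /\
    (forall X (eX : encodable X) (g : X -> instance * nat),
      (forall x, 0 < (g x).2) -> polytime (fun x => enc_bpcsc (g x)) ->
      polyfun (fun x => oracle (g x))).
Proof.
move=> [a [d algo]].
have [z|oracle oracleP] := @choice _ _ (fun z v => 0 < z.2 ->
    (exists2 t, computes_in P (enc_bpcsc z) t (encode (v : seq bool)) &
       t <= a * tree_size (enc_bpcsc z) ^ d) /\ bpcsc_good alpha beta z (encode v)).
  have [z0|z_gt0] := posnP z.2; first by exists [::].
  have [t [y [comp_y le_t good_y]]] := algo z z_gt0.
  have [C [yE _ _ _]] := good_y; exists [seq i \in C | i <- enum 'I_(sets z.1)] => _.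
  by rewrite yE enc_bitvecE in comp_y good_y; split=> //; exists t.
exists oracle; split=> [z /oracleP[] //|X eX g g_gt0 pg].
(* [P] promises nothing for budget 0, so it computes the oracle only on this subtype, through which
   every admissible query factors. *)
pose Y := {z : instance * nat | 0 < z.2}.
pose eY : encodable Y := fun z => enc_bpcsc (sval z).
apply: (@polytime_comp X eX Y eY (fun x => exist _ (g x) (g_gt0 x))
  (fun z => encode (oracle (sval z))) pg).
exists P, (fun z => a * tree_size (encode z) ^ d + (4 * tree_size (encode z) + 1)); split.
  apply: pbound_add.
    by apply: pbound_mul (pbound_const _) _; apply: pbound_exp; apply: pbound_esize.
  apply: pbound_add (pbound_const _); apply: pbound_mul (pbound_const _) _.
  exact: pbound_esize.
move=> [z z_gt0]; have [[t comp_t le_t] [C [CE _ _ _]]] := oracleP z z_gt0.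
exists t; split=> //; first exact: leq_trans le_t (leq_addr _ _).
apply: leq_trans (leq_addl _ _); rewrite /= CE enc_bitvecE.
apply: leq_trans (esize_bits _) _; rewrite size_map size_enum_ord leq_add2r leq_mul2l /=.
exact: sets_le_enc_bpcsc.
Qed.

(** The default value of the minimum has to be dominated too: items times sets bounds the cover time
    of [b]. *)
Lemma cover_time_le_opt (I : instance) (f : rat) (b : seq 'I_(sets I)) K :
    0 < K -> prec_closed_seq b ->
    (forall s : seq 'I_(sets I), pcmssc_feasible f s -> cover_time b <= K * cover_time s) ->
  cover_time b <= K * pcmssc_opt I f.
Proof.
move=> K_gt0 closed_b le_b; rewrite /pcmssc_opt.
elim/big_ind: _ => [|x y le_x le_y|s /le_b //].
- apply: leq_trans (cover_time_le b) _; apply: leq_trans (leq_pmull _ K_gt0).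
  by rewrite leq_mul2l prec_closed_seq_size ?orbT.
- by rewrite /minn; case: ifP.
Qed.

Lemma target_feasible (I : instance) (f : rat) c : (0 <= f)%R ->
  (f * (items I)%:R <= c%:R :> rat)%R = (target (I, f) <= c).
Proof.
move=> f_ge0; rewrite target_leq /=.
have den_gt0 : (0 < (denq f)%:~R :> rat)%R by rewrite ltr0z denq_gt0.
rewrite -{1}(divq_num_den f) mulrAC ler_pdivrMr //.
have numE : numq f = `|numq f|%N by rewrite gez0_abs ?numq_ge0.
have denE : denq f = `|denq f|%N by rewrite gez0_abs // ltW ?denq_gt0.
by rewrite {1}numE {1}denE -!pmulrn -!natrM ler_nat mulnC.
Qed.

Theorem theorem20 (R : realType) :
  exists c : R, forall alpha beta : R, (1 <= alpha)%R -> (1 <= beta)%R ->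
    (exists P : cmd, bpcsc_approx_algorithm alpha beta P) ->
    (exists Q : cmd, pcmssc_approx_algorithm (c * (alpha * beta ^+ 3))%R beta Q).
Proof.
(* 32 from the greedy analysis, times 2 and 4 for rounding alpha and 3 beta up to [A] and [t]. *)
exists 256%:R%R => alpha beta alpha_ge1 beta_ge1 [P /bpcsc_oracle[oracle [good poly]]].
pose A := (Num.truncn alpha).+1; pose t := (Num.truncn (3%:R * beta)%R).+1.
have alpha_ge0 : (0 <= alpha)%R by lra.
have beta3_ge0 : (0 <= 3%:R * beta)%R by lra.
have /andP[A_le A_gt] := truncn_itv alpha_ge0.
have /andP[t_le t_gt] := truncn_itv beta3_ge0.
have A2 : (A%:R <= 2%:R * alpha)%R by rewrite /A -natr1; lra.
have t4 : (t%:R <= 4%:R * beta)%R by rewrite /t -natr1; lra.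
have oracleP I k : 0 < k -> exists C : {set 'I_(sets I)},
    [/\ oracle (I, k) = [seq i \in C | i <- enum 'I_(sets I)], prec_closed C,
        3 * bpcsc_opt I k <= t * #|cov C| & #|C| <= A * k].
  move=> k_gt0; have [C [CE closed_C ratio_C size_C]] := good (I, k) k_gt0.
  exists C; split=> //.
  - by apply: encode_bits_inj; rewrite CE enc_bitvecE.
  - rewrite -(ler_nat R) !natrM.
    rewrite ler_pdivrMr in ratio_C; last by lra.
    have cov_ge0 : (0 <= #|@cov I C|%:R :> R)%R by [].
    have t_ge : (3%:R * beta <= t%:R)%R by apply: ltW.
    move: ratio_C cov_ge0 t_ge; move: (_%:R)%R (_%:R)%R (t%:R)%R => x y z; nra.
  - rewrite -(ler_nat R) natrM; apply: le_trans size_C _.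
    by rewrite ler_wpM2r // ltW.
have [Q [T [[a [d le_T]] QP]]] := polyfun_best_candidate t poly.
exists Q, a, d => -[I f] /andP[f_gt0 f_le1]; have [time [comp_Q le_time _]] := QP (I, f).
have f_ge0 : (0 <= f)%R by apply: ltW.
exists time, (encode (best_candidate oracle t (I, f))); split=> //.
  exact: leq_trans le_time (le_T _).
have [||b [bE closed_b reach_b best_b]] := best_candidateP (t := t) (A := A) isT isT oracleP (p := (I, f)).
- by rewrite -target_feasible //= ler_piMl.
- move=> N0; have := leqnn (target (I, f)); rewrite {2}N0 -target_feasible //.
  rewrite pmulr_rle0 // lern0 => /eqP //.
exists b; split=> //.
- by rewrite bE /encode /encodable_seq enc_seq_map.
- rewrite -target_feasible // in reach_b.
  move: reach_b; rewrite -(ler_rat R) rmorphM /= !ratr_nat => reach_b.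
  rewrite ler_pdivrMr; last by lra.
  apply: (le_trans reach_b); rewrite ler_peMr //.
- have : cover_time b <= 32 * (A * t) * pcmssc_opt I f.
    apply: cover_time_le_opt => // s /andP[closed_s reach_s].
    by apply: best_b => //; rewrite -target_feasible.
  rewrite -(ler_nat R) => /le_trans; apply; rewrite !natrM ler_wpM2r //.
  (* The factor reached so far is 256 alpha beta; the cube enters only here. *)
  have beta3 : (beta <= beta ^+ 3)%R by rewrite ler_eXnr.
  have At : (A%:R * t%:R <= 2%:R * alpha * (4%:R * beta) :> R)%R by rewrite ler_pM.
  have ab : (alpha * beta <= alpha * beta ^+ 3)%R by rewrite ler_wpM2l.
  by move: At ab; set x := (A%:R * _)%R; set y := (alpha * beta ^+ 3)%R; lra.
Qed.
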